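(* (i) There exists an absolute constant $c>0$ such that if $G$ is a uniformly random $n$-vertex $d$-regular graph, where $d=d(n)$ is an integer with $2<d<\frac15\log n$ (and $dn$ even), then with high probability (i.e. with probability tending to $1$ as $n\to\infty$) $$\operatorname{tww}(G)\ge c\,\frac{d}{\sqrt{\log n}}\;n^{\frac{d-2}{2d-2}}.$$ (ii) For every $\varepsilon>0$ there exists a constant $c>0$ (depending only on $\varepsilon$) such that if $G$ is a uniformly random graph on $n$ vertices with $m$ edges, where $m=m(n)$ is an integer with $(1+\varepsilon)n\le m\le\frac1{11}n\log n$, and $d=\operatorname{mad}(G)$, then with high probability $$\operatorname{tww}(G)\ge c\,\frac{d}{\sqrt{\log n}}\;n^{\frac{d-2}{2d-2}}.$$
   Context: All graphs are finite and simple; random graphs have vertex set $\{1,\dots,n\}$; $\log$ is the natural logarithm. The maximum average degree of a graph $G$ is $\operatorname{mad}(G)=\max_{H}\frac{2e(H)}{v(H)}$, over all subgraphs $H$ of $G$ with at least one vertex, where $v(H)$ and $e(H)$ are the numbers of vertices and edges of $H$. Twin-width: a trigraph is a finite vertex set together with two disjoint sets of edges (unordered pairs of distinct vertices), called black and red; a graph is regarded as a trigraph with all edges black. Contracting two distinct (not necessarily adjacent) vertices $u,v$ of a trigraph means replacing them by a new vertex $w$ where, for each other vertex $x$: $wx$ is a black edge if both $ux$ and $vx$ are black edges; $wx$ is a non-edge if neither $ux$ nor $vx$ is an edge (of either colour); and $wx$ is a red edge otherwise; all other edges are unchanged. The twin-width $\operatorname{tww}(G)$ is the minimum integer $w\ge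 0$ such that there is a sequence of contractions from $G$ to a one-vertex trigraph in which, in every trigraph of the sequence, every vertex is incident with at most $w$ red edges. *)

(* Defs.v *)
From HB Require Import structures.
From mathcomp Require Import all_boot all_order all_algebra.
From mathcomp Require Import all_classical all_reals all_analysis.

Set Implicit Arguments.
Unset Strict Implicit.
Unset Printing Implicit Defensive.

Import Order.TTheory GRing.Theory Num.Theory.
Import numFieldNormedType.Exports.

Local Open Scope ring_scope.

(* An edge is represented by the two-element set of its endpoints. *)
Definition pairs (T : finType) (V : {set T}) : {set {set T}} :=
  [set e : {set T} | (e \subset V) && (#|e| == 2)%N].

Record sgraph (T : finType) := SGraph {
  edges : {set {set T}};
  edges_sub : edges \subset pairs [set: T]
}.

HB.instance Definition _ (T : finType) := [isSub for @edges T].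
HB.instance Definition _ (T : finType) := [Finite of sgraph T by <:].

Definition degree (T : finType) (G : sgraph T) (x : T) : nat :=
  #|[set e in edges G | x \in e]|.

Definition regular_graphs (n d : nat) : {set sgraph 'I_n} :=
  [set G : sgraph 'I_n | [forall x, degree G x == d]].

Definition graphs_with_edges (n m : nat) : {set sgraph 'I_n} :=
  [set G : sgraph 'I_n | #|edges G| == m].

(* H = (vertex set, edge set) *)
Definition is_subgraph (T : finType) (H : {set T} * {set {set T}})
    (G : sgraph T) : bool :=
  (H.2 \subset edges G) && (H.2 \subset pairs H.1).

(* All the ratios are nonnegative, so the default value 0 only matters for the
   graph without vertices. *)
Definition mad (R : realType) (T : finType) (G : sgraph T) : R :=
  \big[Num.max/0]_(H : {set T} * {set {set T}}
                  | is_subgraph H G && (H.1 != finset.set0))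
     ((2 * #|H.2|)%N%:R / #|H.1|%:R).

Record trigraph (T : finType) := Trigraph {
  vert : {set T};
  black : {set {set T}};
  red : {set {set T}};
  black_sub : black \subset pairs vert;
  red_sub : red \subset pairs vert;
  black_red_disjoint : [disjoint black & red]
}.

Definition red_degree (T : finType) (G : trigraph T) (x : T) : nat :=
  #|[set e in red G | x \in e]|.

Lemma disjoint_black_red0 (T : finType) (B : {set {set T}}) :
  [disjoint B & (finset.set0 : {set {set T}})].
Proof. by rewrite -setI_eq0 finset.setI0. Qed.

Definition trigraph_of (T : finType) (G : sgraph T) : trigraph T :=
  Trigraph (edges_sub G) (finset.sub0set _) (disjoint_black_red0 (edges G)).

(* The name w of the new vertex is arbitrary among the elements of T that do
   not name a surviving vertex; in particular u and v may be reused, so that T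
   always provides a name. *)
Definition contracts_to (T : finType) (G G' : trigraph T) : Prop :=
  exists u v w : T,
    let W := vert G :\: [set u; v] in
    let blk a x := [set a; x] \in black G in
    let adj a x := [set a; x] \in black G :|: red G in
    [/\ [/\ u \in vert G, v \in vert G, u != v & w \notin W],
        vert G' = w |: W,
        black G' = [set e in black G | e \subset W]
          :|: [set [set w; x] | x in W & blk u x && blk v x]
      & red G' = [set e in red G | e \subset W]
          :|: [set [set w; x] | x in W
                 & ~~ (blk u x && blk v x) && (adj u x || adj v x)]].

Definition tww_at_most (T : finType) (G : sgraph T) (w : nat) : Prop :=
  exists (k : nat) (S : nat -> trigraph T),
    [/\ S 0%N = trigraph_of G,
        forall i, (i < k)%N -> contracts_to (S i) (S i.+1),
        #|vert (S k)| = 1%N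
      & forall i x, (i <= k)%N -> x \in vert (S i) ->
          (red_degree (S i) x <= w)%N].

(* The second branch is only reached when T is empty: see twwP. *)
Definition tww (T : finType) (G : sgraph T) : nat :=
  match pselect (exists w, `[< tww_at_most G w >]) with
  | left exw => ex_minn exw
  | right _ => 0%N
  end.

Section ContractionSequences.
Variable T : finType.

Let contracted (G : trigraph T) (u v : T) : u \in vert G -> v \in vert G ->
  u != v -> exists G', contracts_to G G' /\ #|vert G'| = #|vert G|.-1.
Proof.
move=> uG vG uv.
pose W := vert G :\: [set u; v].
pose blk a x := [set a; x] \in black G.
pose adj a x := [set a; x] \in black G :|: red G.
pose B := [set e in black G | e \subset W]
          :|: [set [set u; x] | x in W & blk u x && blk v x].
pose D := [set e in red G | e \subset W]
          :|: [set [set u; x] | x in W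
                 & ~~ (blk u x && blk v x) && (adj u x || adj v x)].
have uW : u \notin W by rewrite !inE eqxx.
have newP x : x \in W -> [set u; x] \in pairs (u |: W).
  move=> xW; rewrite inE cards2 (_ : u != x) ?andbT; last first.
    by apply: contraNneq uW => ->.
  by apply/fintype.subsetP => y; rewrite !inE => /orP[->//|/eqP->]; move: xW;
     rewrite !inE => ->; rewrite orbT.
have oldP (E : {set {set T}}) e : E \subset pairs (vert G) -> e \in E ->
    e \subset W -> e \in pairs (u |: W).
  move=> /fintype.subsetP sE /sE; rewrite !inE => /andP[_ ->] eW.
  by rewrite andbT (fintype.subset_trans eW) // finset.subsetUr.
have BP : B \subset pairs (u |: W).
  apply/fintype.subsetP => e; rewrite inE => /orP[|/imsetP[x]].
    by rewrite inE => /andP[]; apply: oldP (black_sub G).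
  by rewrite inE => /andP[xW _] ->; apply: newP.
have DP : D \subset pairs (u |: W).
  apply/fintype.subsetP => e; rewrite inE => /orP[|/imsetP[x]].
    by rewrite inE => /andP[]; apply: oldP (red_sub G).
  by rewrite inE => /andP[xW _] ->; apply: newP.
have notW x : [set u; x] \subset W = false.
  by apply/negP => /fintype.subsetP/(_ u); rewrite !inE eqxx => /(_ isT).
have inj x y : x \in W -> [set u; x] = [set u; y] -> x = y.
  move=> xW /setP/(_ x); rewrite !inE eqxx orbT => /esym/orP[/eqP xu|/eqP//].
  by rewrite -xu xW in uW.
have dis : [disjoint B & D].
  apply/pred0P => e /=; apply/negP => /andP[].
  rewrite !inE => /orP[/andP[eB eW]|/imsetP[x]].
    move=> /orP[/andP[eR _]|/imsetP[y _ eE]]; last by rewrite eE notW in eW.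
    by have /pred0P/(_ e) := black_red_disjoint G; rewrite /= eB eR.
  rewrite inE => /andP[xW bx] -> /orP[|/imsetP[y]]; first by rewrite notW andbF.
  by rewrite inE => /andP[_ /andP[by_ _]] /(inj _ _ xW) xy; rewrite -xy bx in by_.
exists (Trigraph BP DP dis); split; first by exists u, v, u.
rewrite /= cardsU1 uW cardsD (finset.setIidPr _) ?cards2 ?uv; last first.
  by apply/fintype.subsetP => y; rewrite !inE => /orP[] /eqP->.
have : (1 < #|vert G|)%N by apply/card_gt1P; exists u, v; split.
by case: #|_| => [|[|k]] //=; rewrite subn2 add1n.
Qed.

Lemma contraction_sequence (G : trigraph T) : (0 < #|vert G|)%N ->
  exists (k : nat) (S : nat -> trigraph T),
    [/\ S 0%N = G,
        forall i, (i < k)%N -> contracts_to (S i) (S i.+1)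
      & #|vert (S k)| = 1%N].
Proof.
move: {2}#|_| (leqnn #|vert G|) => N; elim: N G => [|N IH] G leN G0.
  by move: leN; rewrite leqNgt G0.
have [G1|/card_gt1P[u [v [uG vG uv]]]] := leqP #|vert G| 1.
  by exists 0%N, (fun=> G); split=> //; apply/eqP; rewrite eqn_leq G1 G0.
have G1 : (1 < #|vert G|)%N by apply/card_gt1P; exists u, v; split.
have [G' [GG' cG']] := contracted uG vG uv.
have [||k [S [S0 Sk S1]]] := IH G'; rewrite ?cG'.
- by move: leN; case: #|_|.
- by case: #|_| G1 => [|[]].
exists k.+1, (fun i => if i is j.+1 then S j else G); split=> //.
by case=> [|i] ik; [rewrite S0|apply: Sk].
Qed.

Lemma twwP (G : sgraph T) : (0 < #|T|)%N ->
  tww_at_most G (tww G) /\ forall w, tww_at_most G w -> (tww G <= w)%N.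
Proof.
move=> T0; rewrite /tww; case: pselect => [exw|[]].
  by case: ex_minnP => w /asboolP Gw min; split=> // w' /asboolP; apply: min.
have [|k [S [S0 Sk S1]]] := @contraction_sequence (trigraph_of G).
  by rewrite /= cardsT.
exists #|{set T}|; apply/asboolP; exists k, S; split=> // i x _ _.
exact: max_card.
Qed.

End ContractionSequences.

(* Probability of the event A for a uniformly random element of Omega (which is
   0 if Omega is empty). *)
Definition prob_uniform (R : realType) (U : finType) (Omega : {set U})
    (A : pred U) : R :=
  #|[set G in Omega | A G]|%:R / #|Omega|%:R.

Definition tww_bound (R : realType) (n : nat) (d : R) : R :=
  d / Num.sqrt (ln n%:R) * n%:R `^ ((d - 2) / (2 * d - 2)).

(* p n tends to 1 as n tends to infinity through the elements of S. *)
Definition tends_to_one_along (R : realType) (S : nat -> Prop)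
    (p : nat -> R) : Prop :=
  (p n @[n --> within S \oo] --> (1 : R))%classic.

(* Main.v *)
Require Import Defs.
From mathcomp Require Import all_boot all_order all_fingroup all_algebra.
From mathcomp Require Import all_classical all_reals all_analysis.
From mathcomp Require Import zify ring lra.

(* A contraction sequence of width w gives a cheap description of the edges of
   G.  Fix a vertex set U with u elements and a size s larger than the maximum
   degree.  Along the sequence each part keeps a residual set of fewer than s
   vertices of U; whenever a contraction brings together a residual set of at
   least s vertices, this set is frozen as a piece, of size at most 2s.  At that
   moment its part has at most w red neighbours and no black one (a vertex of a
   black neighbour would have degree at least s), and the residual set of each
   of these parts ends up inside one later piece.  So U splits into k <= u/s + 1
   pieces of size at most 2s, at most kw pairs of pieces carry edges, and all
   the edges inside U lie in a set of at most k(w+1)(2s)^2 pairs of vertices.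
   With n^((d-2)/(2d-2)) sqrt(log n) / d as s and w below the claimed bound, the
   number of choices for U, the pieces and the pairs of pieces, times the
   probability that du/2 edges fall inside the given set of pairs, is at most
   exp(-du).  This union bound is applied with U the whole vertex set for
   regular graphs, and with U spanning a subgraph of maximum average degree for
   the other model, where first moments exclude high degrees and small dense U.
   Conditioning on d-regularity costs only a factor C^(dn/2), because the lifts
   of the complete graph K_(d+1) already provide (n/(Cd))^(dn/2) regular graphs. *)

Import Order.TTheory GRing.Theory Num.Theory.
Set Implicit Arguments.
Unset Strict Implicit.
Unset Printing Implicit Defensive.
Local Open Scope ring_scope.

(** * Freezing pieces along a contraction sequence *)

Section Structure.
Variables (T : finType) (G : sgraph T).
Local Open Scope nat_scope.

(* [p] maps a vertex of [G] to the vertex of [H] it has been contracted to. *)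
Definition models (H : trigraph T) (p : T -> T) :=
  [/\ forall x, p x \in vert H,
      forall x y, [set x; y] \in edges G -> p x != p y ->
        [set p x; p y] \in black H :|: red H
    & forall x y, [set p x; p y] \in black H -> [set x; y] \in edges G].

(** The name [w] may be [u], [v] or any element outside the surviving vertices. The last clause
    excludes a clash with a surviving part, so the fibre over [w] is exactly the union of the fibres
    over [u] and [v]. *)
Lemma models_step (H H' : trigraph T) (p : T -> T) :
  models H p -> contracts_to H H' -> exists u v w : T,
    models H' (fun x => if p x \in [set u; v] then w else p x)
    /\ forall x, p x \notin [set u; v] -> p x != w.
Proof.
move=> [Hp1 Hp2 Hp3] [u [v [w [[uH vH uv wW] Ev Eb Er]]]].
exists u, v, w.
set W := vert H :\: [set u; v] in wW Ev Eb Er.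
have inW x : p x \notin [set u; v] -> p x \in W.
  by move=> hx; rewrite inE hx Hp1.
have neW z : z \in W -> z != w by apply: contraTneq => ->.
have hadj x z : p x \in [set u; v] -> z \in W ->
    [set p x; z] \in black H :|: red H ->
    [set w; z] \in black H' :|: red H'.
  move=> hx zW hxz; rewrite inE Eb Er.
  case hb : (([set u; z] \in black H) && ([set v; z] \in black H)).
    apply/orP; left; rewrite inE; apply/orP; right.
    by apply/imsetP; exists z => //; rewrite inE zW hb.
  apply/orP; right; rewrite inE; apply/orP; right.
  apply/imsetP; exists z => //; rewrite inE zW hb /=.
  by move: hx hxz; rewrite !inE => /orP[]/eqP-> ->; rewrite ?orbT.
split; last by move=> x /inW/neW.
split.
- move=> x; rewrite Ev; case: ifPn => [_|/inW h]; rewrite !inE ?eqxx //.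
  by move: h; rewrite !inE => ->; rewrite orbT.
- move=> x y exy.
  case: ifPn => hx; case: ifPn => hy; rewrite ?eqxx //.
  + move=> _; apply: (hadj x) (inW _ hy) _ => //; apply: Hp2 exy _.
    by apply: contraNneq hy => <-.
  + move=> _; rewrite finset.setUC; apply: (hadj y) (inW _ hx) _ => //.
    rewrite finset.setUC; apply: Hp2 exy _.
    by apply: contraNneq hx => ->.
  + move=> nxy; have := Hp2 _ _ exy nxy.
    have sW : [set p x; p y] \subset W.
      by apply/fintype.subsetP => z; rewrite inE => /orP[] /set1P->; apply: inW.
    by rewrite !inE Eb Er !inE sW !andbT => /orP[] ->; rewrite ?orbT.
move=> x y; rewrite Eb inE => /orP[|].
  rewrite inE => /andP[hb /fintype.subsetP hW].
  have hx z : (if p z \in [set u; v] then w else p z) \in W ->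
     p z \notin [set u; v].
    by case: ifPn => // _; rewrite (negbTE wW).
  have := hx x (hW _ (set21 _ _)); have := hx y (hW _ (set22 _ _)).
  by move=> /negbTE hy /negbTE hx'; move: hb; rewrite hx' hy; apply: Hp3.
case/imsetP => z; rewrite inE => /andP[zW /andP[bu bv]] E.
have key a b : (if p a \in [set u; v] then w else p a) = w ->
     (if p b \in [set u; v] then w else p b) = z -> [set a; b] \in edges G.
  case: ifPn => [ha _|/inW/neW/eqP//].
  case: ifPn => [_ wz|hb hz]; first by move: (neW _ zW); rewrite wz eqxx.
  apply: Hp3; rewrite hz; move: ha; rewrite !inE => /orP[]/eqP-> //.
(* Equal unordered pairs give four ways of matching [a], [b] with [w], [z]; the two constant ones
   contradict [z != w]. *)
set a := (if p x \in _ then _ else _) in E.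
set b := (if p y \in _ then _ else _) in E.
have : z \in [set a; b] by rewrite E set22.
have : w \in [set a; b] by rewrite E set21.
have : a \in [set w; z] by rewrite -E set21.
have : b \in [set w; z] by rewrite -E set22.
rewrite !inE => /orP[]/eqP hb /orP[]/eqP ha; rewrite ?ha ?hb.
- by move=> _ /orP[] /eqP h; move: (neW _ zW); rewrite h eqxx.
- by move=> _ _; rewrite finset.setUC; apply: key.
- by move=> _ _; apply: key.
- by move=> /orP[] /eqP h; move: (neW _ zW); rewrite h eqxx.
Qed.

Variables (w s k : nat) (S : nat -> trigraph T).
Hypothesis Sc : forall i, i < k -> contracts_to (S i) (S i.+1).
Hypothesis S1 : #|vert (S k)| = 1.
Hypothesis Sr : forall i x, i <= k -> x \in vert (S i) -> red_degree (S i) x <= w.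
Hypothesis degs : forall x, degree G x < s.

(** Otherwise the distinct pairs from [y] to [X] would give [y] degree at least [s]. A black edge
    from the part of a frozen piece [X] to the part of [y] would create this situation, so only red
    edges remain. *)
Lemma not_all_adjacent (X : {set T}) y : s <= #|X| ->
  ~ (forall x, x \in X -> [set x; y] \in edges G).
Proof.
move=> sX h; have := degs y; rewrite ltnNge => /negP; apply.
apply: leq_trans sX _.
have yX x : x \in X -> x != y.
  move=> /h hx; have := fintype.subsetP (edges_sub G) _ hx.
  by rewrite inE cards2 => /andP[_]; case: (x != y).
rewrite -(card_in_imset (f := fun x => [set x; y])).
  apply: subset_leq_card; apply/fintype.subsetP => e /imsetP[x xX ->].
  by rewrite inE h // set22.
move=> x x' xX x'X /= E; have : x \in [set x'; y] by rewrite -E set21.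
by rewrite !inE (negbTE (yX _ xX)) orbF => /eqP.
Qed.

(* The pieces of [A] are numbered by [g] in the reverse order of their freezing,
   so [Q l] contains the pieces adjacent to piece [l] and frozen after it. *)
Lemma freeze j : j <= k -> forall (p : T -> T) (A : {set T}),
  models (S (k - j)) p -> (forall z, #|[set x in A | p x == z]| < s) ->
  exists (K : nat) (g : T -> nat) (Q : rel nat),
   [/\ K * s <= #|A| + s,
       forall x, x \in A -> g x < K,
       forall x y, x \in A -> y \in A -> p x = p y -> g x = g y,
       forall l, #|[set x in A | g x == l]| <= 2 * s
     & (forall l, count (Q l) (iota 0 K) <= w) /\
       forall x y, x \in A -> y \in A -> [set x; y] \in edges G ->
         [|| g x == g y, Q (g x) (g y) | Q (g y) (g x)]].
Proof.
elim: j => [|j IH] jk p A mp As.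
  rewrite subn0 in mp; case: mp => p1 _ _.
  (* One part is left, and the rest of [A] becomes a last piece, possibly with fewer than [s]
     vertices: this is the slack [+ s] in the bound on [K]. *)
  exists 1, (fun=> 0), (fun _ _ => false).
  have [z Ez] : exists z, vert (S k) = [set z] by apply/cards1P; rewrite S1.
  split => //.
  - by rewrite mul1n leq_addl.
  - move=> l; have := As z; rewrite (_ : [set x in A | p x == z] = A).
      move=> h; apply: leq_trans (_ : s <= _); last by lia.
      apply: leq_trans (ltnW h); apply: subset_leq_card.
      by apply/fintype.subsetP => x; rewrite inE => /andP[].
    apply/setP => x; rewrite inE; have := p1 x; rewrite Ez inE => ->.
    by rewrite andbT.
have jk' : k - j.+1 < k by lia.
have Ej : (k - j.+1).+1 = k - j by lia.
have [u [v [c [mp' cne]]]] := models_step mp (Sc jk').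
rewrite Ej in mp'.
set p' := fun x => _ in mp'.
have pp' x y : p x = p y -> p' x = p' y by rewrite /p' => ->.
have sz z : z != c -> [set x in A | p' x == z] \subset [set x in A | p x == z].
  move=> zc; apply/fintype.subsetP => x; rewrite !inE => /andP[->].
  by rewrite /p'; case: ifP => // _; rewrite eq_sym (negbTE zc).
pose X := [set x in A | p' x == c].
have X2 : #|X| <= 2 * s.
  have : X \subset [set x in A | p x == u] :|: [set x in A | p x == v].
    apply/fintype.subsetP => x; rewrite !inE => /andP[-> /=].
    rewrite /p' !inE; case: ifPn => // h /eqP hc.
    by have := cne x; rewrite !inE => /(_ h); rewrite hc eqxx.
  move/subset_leq_card => h; apply: leq_trans h _.
  apply: leq_trans (leq_card_setU _ _) _.
  have := As u; have := As v; lia.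
have [Xs|sX] := ltnP #|X| s.
  have As' z : #|[set x in A | p' x == z]| < s.
    case: (eqVneq z c) => [->//|zc].
    by apply: leq_ltn_trans (subset_leq_card (sz z zc)) (As z).
  have [K [g [Q [h1 h2 h3 h4 h5]]]] := IH (ltnW jk) p' A mp' As'.
  by exists K, g, Q; split => // x y xA yA /pp'; apply: h3.
pose A' := A :\: X.
have XA : X \subset A by apply/fintype.subsetP => x; rewrite inE => /andP[].
have As' z : #|[set x in A' | p' x == z]| < s.
  case: (eqVneq z c) => [->|zc].
    rewrite (_ : [set _ in _ | _] = finset.set0) ?cards0.
      by have := degs c; lia.
    by apply/setP => x; rewrite !inE; case: (x \in A) => //=; case: eqP.
  apply: leq_ltn_trans (As z); apply: leq_trans (subset_leq_card (sz z zc)).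
  apply: subset_leq_card; apply/fintype.subsetP => x.
  by rewrite !inE => /andP[/andP[_ ->] ->].
have [K [g [Q [h1 h2 h3 h4 [h5 h6]]]]] := IH (ltnW jk) p' A' mp' As'.
(* [X] is frozen now and gets the largest number [K]; its row of [Q] lists the later pieces that
   contain a vertex whose part is a red neighbour of [c] at this moment. *)
pose nb l := [exists y in A', (g y == l) && ([set c; p' y] \in red (S (k - j)))].
exists K.+1, (fun x => if x \in X then K else g x),
  (fun l l' => if l == K then nb l' && (l' < K) else (l' < K) && Q l l').
have inA' x : x \in A -> x \notin X -> x \in A' by move=> hA hX; rewrite finset.in_setD hX.
have cardA : #|A'| + #|X| = #|A|.
  by rewrite -(cardsID X A) (finset.setIidPr XA) addnC.
have [p1 p2 p3] := mp'.
split.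
- rewrite mulSn; lia.
- move=> x xA; case: ifPn => // xX; apply: ltnW; apply: h2; exact: inA'.
- move=> x y xA yA pxy; have : (x \in X) = (y \in X).
    by rewrite !inE xA yA (pp' _ _ pxy).
  move=> E; rewrite -E; case: ifPn => // xX.
  by apply: h3; rewrite ?inA' -?E ?(pp' _ _ pxy).
- move=> l; case: (eqVneq l K) => [->|lK].
    apply: leq_trans X2; apply: subset_leq_card.
    apply/fintype.subsetP => x; rewrite inE => /andP[xA]; case: ifPn => // xX /eqP E.
    by have := h2 x (inA' _ xA xX); rewrite E ltnn.
  apply: leq_trans (h4 l); apply: subset_leq_card.
  apply/fintype.subsetP => x; rewrite inE => /andP[xA].
  case: ifPn => xX; first by rewrite eq_sym (negbTE lK).
  by rewrite inE inA'.
split=> [l|].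
  (* Column [K] counts for nothing, since both branches require [l' < K]. *)
  rewrite -addn1 iotaD add0n count_cat /= ltnn !andbF if_same !addn0.
  case: (eqVneq l K) => [_|lK]; last first.
    apply: leq_trans (h5 l).
    by apply: sub_count => l' /andP[].
  have cS : c \in vert (S (k - j)).
    have : 0 < #|X| by have := degs c; lia.
    case/card_gt0P => x; rewrite inE => /andP[_ /eqP <-]; exact: p1.
  apply: leq_trans (_ : red_degree (S (k - j)) c <= w); last first.
    by apply: Sr => //; lia.
  rewrite /red_degree.
  (* [h] sends a red edge at [c] to the piece of the vertices at its other end. By [h3] the picked
     vertex does not matter, so row [K] has at most as many pieces as [c] has red edges. *)
  pose h (e : {set T}) : nat := if [pick y in A' | e == [set c; p' y]] is Some y then g y else 0.
  pose B := [set e in red (S (k - j)) | c \in e].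
  apply: leq_trans (_ : size (map h (enum B)) <= _); last by rewrite size_map cardE.
  rewrite -size_filter; apply: uniq_leq_size.
    by rewrite filter_uniq // iota_uniq.
  move=> l'; rewrite mem_filter => /andP[/andP[/existsP[y /and3P[yA /eqP <- ey]] _] _].
  apply/mapP; exists [set c; p' y]; first by rewrite mem_enum inE ey set21.
  rewrite /h; case: pickP => [y' /andP[y'A /eqP E]|/(_ y)]; last by rewrite yA eqxx.
  apply: h3 => //.
  have ncy z : z \in A' -> p' z != c.
    by rewrite !inE negb_and => /andP[/orP[/negbTE-> //|]].
  have : p' y \in [set c; p' y'] by rewrite -E set22.
  by rewrite !inE (negbTE (ncy _ yA)) => /eqP.
have key x y : x \in X -> y \in A' -> [set x; y] \in edges G -> nb (g y).
  move=> xX yA exy; apply/existsP; exists y; rewrite yA eqxx /=.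
  have xc : p' x = c by move: xX; rewrite inE => /andP[_ /eqP].
  have yc : p' y != c.
    by move: yA; rewrite !inE negb_and => /andP[/orP[/negbTE-> //|]].
  have := p2 _ _ exy; rewrite xc eq_sym => /(_ yc); rewrite inE => /orP[hb|//].
  exfalso; apply: (@not_all_adjacent X y sX) => z; rewrite inE => /andP[_ /eqP zc].
  by apply: p3; rewrite zc.
move=> x y xA yA exy.
case: (boolP (x \in X)) => xX; case: (boolP (y \in X)) => yX; rewrite ?eqxx //.
- have yA' := inA' _ yA yX.
  by rewrite (key x) // h2 // /= !orbT.
- have xA' := inA' _ xA xX.
  by rewrite (key y) // ?h2 // 1?finset.setUC //= !orbT.
- have xA' := inA' _ xA xX; have yA' := inA' _ yA yX.
  have := h2 _ xA'; have := h2 _ yA' => hy hx.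
  have := h6 _ _ xA' yA' exy.
  by rewrite !(ltn_eqF hx, ltn_eqF hy) hx hy.
Qed.

End Structure.

Lemma leq_card_bigcup (I J : finType) (P : pred I) (A : I -> {set J}) :
  (#|\bigcup_(i | P i) A i| <= \sum_(i | P i) #|A i|)%N.
Proof.
elim/big_rec2: _ => [|q m B _ h]; first by rewrite cards0.
by apply: leq_trans (leq_card_setU _ _) _; rewrite leq_add2l.
Qed.

(** * Sets of pairs spanned by pieces and pairs of pieces *)

Section Hull.
Variable T : finType.
Local Open Scope nat_scope.

(** The case [z.1 = z.2] is allowed, so singletons may occur; this is harmless for covering edges
    and for upper bounds on the size. *)
Definition hull (U : {set T}) k (f : {ffun T -> 'I_k}) (Q : {set 'I_k * 'I_k})
    : {set {set T}} :=
  [set [set z.1; z.2] | z : T * T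
     & [&& z.1 \in U, z.2 \in U & (f z.1, f z.2) \in Q]].

Lemma card_hull (U : {set T}) k (f : {ffun T -> 'I_k}) (Q : {set 'I_k * 'I_k}) b :
  (forall i, #|[set x in U | f x == i]| <= b) -> #|hull U f Q| <= #|Q| * b ^ 2.
Proof.
move=> fb; apply: leq_trans (leq_imset_card _ _) _.
pose C i := [set x in U | f x == i].
apply: (@leq_trans #|\bigcup_(q in Q) finset.setX (C q.1) (C q.2)|).
  apply: subset_leq_card; apply/fintype.subsetP => -[x y].
  rewrite inE /= => /and3P[xU yU xyQ]; apply/bigcupP; exists (f x, f y) => //.
  by rewrite !inE /= xU yU !eqxx.
apply: leq_trans (_ : \sum_(q in Q) #|finset.setX (C q.1) (C q.2)| <= _).
  exact: leq_card_bigcup.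
rewrite -sum_nat_const; apply: leq_sum => q _.
by rewrite cardsX expnS expn1; apply: leq_mul; apply: fb.
Qed.

(** The piece map is frozen at [ord0] outside [U], so that the number of maps is a power with
    exponent [#|U|] and not [#|T|]. The parameter [b] stands for the product of the sizes of two
    pieces. *)
Definition hulls (U : {set T}) k q b : {set {set {set T}}} :=
  [set P in [set hull U z.1 z.2
     | z in finset.setX [set f in pffun_on (ord0 : 'I_k.+1) (mem U) predT]
                        [set Q : {set 'I_k.+1 * 'I_k.+1} | #|Q| <= q]]
     | #|P| <= q * b].

Lemma card_hulls (U : {set T}) k q b :
  #|hulls U k q b| <= k.+1 ^ #|U| * #|[set Q : {set 'I_k.+1 * 'I_k.+1} | #|Q| <= q]|.
Proof.
apply: leq_trans (_ : #|[set hull U z.1 z.2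
     | z in finset.setX [set f in pffun_on (ord0 : 'I_k.+1) (mem U) predT]
                        [set Q : {set 'I_k.+1 * 'I_k.+1} | #|Q| <= q]]| <= _).
  by apply: subset_leq_card; apply/fintype.subsetP => P; rewrite inE => /andP[].
apply: leq_trans (leq_imset_card _ _) _.
by rewrite cardsX leq_mul // cardsE card_pffun_on card_ord.
Qed.

(** Freezing starts from the identity map, whose fibres have at most one element; this is below [s]
    because [1 < s]. *)
Lemma hulls_cover (G : sgraph T) (U : {set T}) w s : 1 < s ->
  (forall x, degree G x < s) -> tww_at_most G w ->
  exists2 P, P \in hulls U (#|U| %/ s) ((#|U| %/ s).+1 * w.+1) ((2 * s) ^ 2)
    & edges G :&: pairs U \subset P.
Proof.
move=> s1 degs [m [S [S0 Sc S1 Sr]]].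
have m0 : models G (S (m - m)) id.
  rewrite subnn S0; split => // x y; rewrite ?inE //=.
  by move=> ->.
have U0 z : #|[set x in U | id x == z]| < s.
  apply: leq_ltn_trans s1; rewrite -(cards1 z); apply: subset_leq_card.
  by apply/fintype.subsetP => x; rewrite !inE => /andP[].
have [K [g [Q [h1 h2 _ h4 [h5 h6]]]]] := freeze Sc S1 Sr degs (leqnn m) m0 U0.
set k := #|U| %/ s.
have Kk : K <= k.+1.
  have s0 : 0 < s by lia.
  by have := h1; rewrite -leq_divRL // divnDr // divnn s0 addn1.
pose f := [ffun x : T => if x \in U then inord (g x) else ord0 : 'I_k.+1].
have fg x : x \in U -> f x = g x :> nat.
  by move=> xU; rewrite ffunE xU inordK // (leq_trans (h2 _ xU)).
(* The diagonal takes care of the edges inside a piece and turns [w] into [w.+1] pairs per row. *)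
pose Q' := [set z : 'I_k.+1 * 'I_k.+1 | (z.1 == z.2) || (z.2 < K) && Q z.1 z.2].
have cQ : #|Q'| <= k.+1 * w.+1.
  rewrite (_ : k.+1 * w.+1 = \sum_(i < k.+1) w.+1); last by rewrite sum_nat_const card_ord.
  pose R i := [set j : 'I_k.+1 | (i, j) \in Q'].
  apply: (@leq_trans #|\bigcup_i finset.setX [set i] (R i)|).
    apply: subset_leq_card; apply/fintype.subsetP => -[a b] ab.
    by apply/bigcupP; exists a => //; rewrite finset.in_setX finset.in_set1 eqxx inE.
  apply: leq_trans (leq_card_bigcup _ _) _.
  apply: leq_sum => i _; rewrite cardsX cards1 mul1n -[w.+1]add1n.
  apply: leq_trans (_ : #|[set i] :|: [set j : 'I_k.+1 | (j < K) && Q i j]| <= _).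
    apply: subset_leq_card; apply/fintype.subsetP => j; rewrite !inE /= eq_sym.
    by [].
  apply: leq_trans (leq_card_setU _ _) _; rewrite cards1 leq_add2l.
  apply: leq_trans (h5 i); rewrite -size_filter.
  rewrite cardE -(size_map (@nat_of_ord k.+1)); apply: uniq_leq_size.
    by rewrite (map_inj_uniq (@ord_inj _)) enum_uniq.
  move=> l /mapP[j]; rewrite mem_enum inE => /andP[jK Qij] ->.
  by rewrite mem_filter Qij mem_iota.
exists (hull U f Q').
  rewrite inE; apply/andP; split.
    apply/imsetP; exists (f, Q') => //; rewrite finset.in_setX !inE cQ andbT.
    apply/pffun_onP; split=> //; apply/supportP => x xU.
    by rewrite ffunE (negbTE xU).
  apply: leq_trans (card_hull (b := 2 * s) _ _) _; last by rewrite leq_mul2r cQ orbT.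
  move=> i; apply: leq_trans (h4 i); apply: subset_leq_card.
  apply/fintype.subsetP => x; rewrite !inE => /andP[xU /eqP <-].
  by rewrite xU fg /=.
apply/fintype.subsetP => e; rewrite !inE => /andP[eG /andP[eU /cards2P[x [y [xy E]]]]].
have xU : x \in U by apply: (fintype.subsetP eU); rewrite E set21.
have yU : y \in U by apply: (fintype.subsetP eU); rewrite E set22.
have := h6 x y xU yU; rewrite -E => /(_ eG).
have : (f x == f y) = (g x == g y) by rewrite -val_eqE /= !fg.
move=> Ef /or3P[h|h|h]; apply/imsetP.
- by exists (x, y); rewrite // !inE /= xU yU Ef h.
- by exists (x, y); rewrite // !inE /= xU yU !fg // h h2 // orbT.
- by exists (y, x); rewrite /= 1?finset.setUC // !inE /= xU yU !fg // h h2 // orbT.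
Qed.
End Hull.

(* Every small set contributes at least [x ^+ q] to the sum of all the
   [x ^+ #|Q|], which is [(1 + x) ^+ #|I|]. *)
Lemma card_small_sets (R : realType) (I : finType) q (x : R) : 0 <= x -> x <= 1 ->
  #|[set Q : {set I} | (#|Q| <= q)%N]|%:R * x ^+ q <= expR (x * #|I|%:R).
Proof.
move=> x0 x1.
apply: (@le_trans _ _ ((x + 1) ^+ #|I|)); last first.
  rewrite mulrC expRM_natl; apply: lerXn2r; rewrite ?nnegrE ?expR_ge0 ?addr_ge0 //.
  by rewrite addrC expR_ge1Dx.
have -> : (x + 1) ^+ #|I| = \sum_(J : {set I}) x ^+ #|J|.
  rewrite -prodr_const bigA_distr; apply: eq_bigr => J _.
  by rewrite -big_mkcond /= prodr_const.
rewrite (bigID (fun J : {set I} => (#|J| <= q)%N)) /=.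
apply: ler_wpDr; first by apply: sumr_ge0 => J _; rewrite exprn_ge0.
rewrite -sum1dep_card natr_sum mulr_suml.
apply: ler_sum => J Jq; rewrite mul1r; exact: ler_wiXn2l.
Qed.

(** * Graphs meeting a given set of pairs *)

Section Counting.
Variable T : finType.
Local Open Scope nat_scope.
Notation P0 := (pairs [set: T]).

Lemma card_pairs (V : {set T}) : #|pairs V| = 'C(#|V|, 2).
Proof. exact: cards_draws. Qed.

Definition graph_of (E : {set {set T}}) : sgraph T :=
  SGraph (finset.subsetIr E P0).

Lemma edges_inj : injective (@edges T).
Proof. exact: val_inj. Qed.

Lemma card_graphs (p : pred {set {set T}}) :
  #|[set G : sgraph T | p (edges G)]| = #|[set E : {set {set T}} | (E \subset P0) && p E]|.
Proof.
rewrite -(card_imset _ edges_inj); apply: eq_card => E; rewrite !inE.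
apply/imsetP/andP => [[G]|[sE pE]].
  by rewrite inE => pG ->; split => //; apply: edges_sub.
exists (graph_of E) => /=; last by rewrite (finset.setIidPl sE).
by rewrite inE /= (finset.setIidPl sE).
Qed.

(** The boolean factor covers [m < #|F|]: there is no such set then, while the truncated difference
    would make the binomial coefficient 1. *)
Lemma card_supersets (I : finType) (B F : {set I}) m :
  F \subset B ->
  #|[set A : {set I} | [&& A \subset B, F \subset A & #|A| == m]]|
   <= (#|F| <= m) * 'C(#|B| - #|F|, m - #|F|).
Proof.
move=> FB; have [Fm|Fm] := leqP #|F| m; last first.
  rewrite mul0n leqn0 cards_eq0; apply/eqP/setP => A; rewrite !inE.
  apply/negP => /and3P[_ /subset_leq_card h /eqP h']; lia.
rewrite mul1n -(finset.setIidPr FB) -cardsD -cards_draws.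
rewrite (finset.setIidPr FB).
rewrite -(card_in_imset (f := fun A => A :\: F)).
  apply: subset_leq_card; apply/fintype.subsetP => A' /imsetP[A].
  rewrite inE => /and3P[AB FA /eqP Am] ->; rewrite inE finset.setSD //=.
  by rewrite cardsD (finset.setIidPr FA) Am.
move=> A A'; rewrite !inE => /and3P[_ FA _] /and3P[_ FA' _] E.
by rewrite -(finset.setID A F) -(finset.setID A' F) E (finset.setIidPr FA) (finset.setIidPr FA').
Qed.

(** The quotient of the two binomial coefficients is the product of the [(m - i) / (N - i)] for
    [i < j], each at most [m / N]. *)
Lemma bin_ratio N m j : j <= m -> m <= N ->
  'C(N - j, m - j) * N ^ j <= m ^ j * 'C(N, m).
Proof.
elim: j => [|j IH] jm mN; first by rewrite !subn0 !expn0 muln1 mul1n.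
have {}IH := IH (ltnW jm) mN.
case: N => [|N] in IH mN *; first by lia.
case: m => [|m] in IH mN jm *; first by lia.
have e1 : (N.+1 - j) * 'C(N.+1 - j.+1, m.+1 - j.+1) = (m.+1 - j) * 'C(N.+1 - j, m.+1 - j).
  have -> : N.+1 - j = (N - j).+1 by lia.
  have -> : m.+1 - j = (m - j).+1 by lia.
  by rewrite !subSS mul_bin_diag.
have Nj : 0 < N.+1 - j by lia.
rewrite -(leq_pmul2l Nj) mulnA e1 !expnS.
have k : (m.+1 - j) * N.+1 <= m.+1 * (N.+1 - j) by nia.
rewrite mulnACA; apply: leq_trans (leq_mul k IH) _.
by rewrite [m.+1 * _]mulnC -!mulnA.
Qed.

(** A union bound over the [j]-element sets [F] of pairs in [P]: a proportion of at most
    [(m / n) ^ j] of the graphs contains a given [F]. Here [n] is the number of all pairs. *)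
Lemma card_graphs_meeting n m (P : {set {set T}}) j :
  n = #|P0| -> m <= n ->
  #|[set G : sgraph T | (#|edges G| == m) && (j <= #|edges G :&: P|)]| * n ^ j
   <= 'C(#|P|, j) * m ^ j * #|[set G : sgraph T | #|edges G| == m]|.
Proof.
move=> En mn.
rewrite (card_graphs (fun E => (#|E| == m) && (j <= #|E :&: P|))).
rewrite (card_graphs (fun E => #|E| == m)) cards_draws -En.
pose Fs := [set F : {set {set T}} | (F \subset P0 :&: P) && (#|F| == j)].
have Fs_le : #|Fs| <= 'C(#|P|, j).
  rewrite cards_draws; apply: leq_bin2l; apply: subset_leq_card; exact: finset.subsetIr.
have [mj|jm] := ltnP m j.
  rewrite (_ : [set _ | _] = finset.set0) ?cards0 //.
  apply/setP => E; rewrite !inE; apply/negP => /and3P[_ /eqP Em h].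
  have := subset_leq_card (finset.subsetIl E P); lia.
pose Sup (F : {set {set T}}) := [set A : {set {set T}} | [&& A \subset P0, F \subset A & #|A| == m]].
apply: (@leq_trans ((\sum_(F in Fs) #|Sup F|) * n ^ j)).
  rewrite leq_mul2r; apply/orP; right.
  apply: leq_trans (_ : #|\bigcup_(F in Fs) Sup F| <= _).
    apply: subset_leq_card; apply/fintype.subsetP => E; rewrite inE => /and3P[sE Em jE].
    have [F] : exists F, F \in [set F : {set {set T}} | (F \subset E :&: P) && (#|F| == j)].
      by apply/card_gt0P; rewrite cards_draws bin_gt0.
    rewrite inE => /andP[FEP Fj]; apply/bigcupP; exists F.
      by rewrite inE Fj andbT (fintype.subset_trans FEP) // finset.setSI.
    by rewrite inE sE Em (fintype.subset_trans FEP) // finset.subsetIl.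
  elim/big_rec2: _ => [|q b A _ h]; first by rewrite cards0.
  by apply: leq_trans (leq_card_setU _ _) _; rewrite leq_add2l.
apply: leq_trans (_ : #|Fs| * 'C(n - j, m - j) * n ^ j <= _).
  rewrite leq_mul2r -sum_nat_const; apply/orP; right; apply: leq_sum => F.
  rewrite inE => /andP[FP /eqP Fj].
  have := card_supersets m (fintype.subset_trans FP (finset.subsetIl _ _)).
  by rewrite Fj jm mul1n -En.
by rewrite -!mulnA; apply: leq_mul => //; apply: bin_ratio.
Qed.
End Counting.

(** * A lower bound on the number of regular graphs *)

Section RelGraph.
Variables (T : finType) (e : rel T).
Local Open Scope nat_scope.
Hypotheses (es : symmetric e) (ei : irreflexive e).

Definition rel_graph : sgraph T :=
  graph_of [set E : {set T} | [exists x, exists y, (E == [set x; y]) && e x y]].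

Lemma rel_graphE x y : ([set x; y] \in edges rel_graph) = e x y.
Proof.
rewrite !inE cards2 finset.subsetT /=; apply/andP/idP => [[/existsP[a /existsP[b]]]|exy].
  case/andP => /eqP E eab nxy.
  have hx : x \in [set a; b] by rewrite -E set21.
  have hy : y \in [set a; b] by rewrite -E set22.
  have {}nxy : x != y by move: nxy; case: (x != y).
  move: hx hy nxy; rewrite !inE => /orP[]/eqP-> /orP[]/eqP->; rewrite ?eqxx //.
  by rewrite es.
split; first by apply/existsP; exists x; apply/existsP; exists y; rewrite eqxx.
have -> : x != y by apply: contraTneq exy => ->; rewrite ei.
by [].
Qed.

Lemma rel_graph_degree x : degree rel_graph x = #|[set y | e x y]|.
Proof.
rewrite -(card_in_imset (f := fun y => [set x; y])); last first.
  move=> y z; rewrite !inE => exy exz E.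
  have : y \in [set x; z] by rewrite -E set22.
  by rewrite !inE => /orP[/eqP yx|/eqP//]; move: exy; rewrite yx ei.
apply: eq_card => E; rewrite inE; apply/andP/imsetP => [[EG xE]|[y]].
  have /= := fintype.subsetP (edges_sub rel_graph) _ EG.
  rewrite inE => /andP[_ /cards2P[a [b [ab Eab]]]]; move: EG xE; rewrite Eab.
  rewrite rel_graphE !inE => eab /orP[]/eqP->.
    by exists b; rewrite ?inE.
  by exists a; rewrite ?inE 1?es // finset.setUC.
by rewrite inE => exy ->; rewrite rel_graphE exy set21.
Qed.
End RelGraph.

(** Transport along [enum_val] allows regular graphs to be built on whatever vertex type is
    convenient. *)
Lemma card_regular_ge (L I : finType) (P : {set I}) (e : I -> rel L) d :
  (forall i, i \in P -> [/\ symmetric (e i), irreflexive (e i)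
       & forall x, #|[set y | e i x y]| = d]) ->
  (forall i j, i \in P -> j \in P -> e i =2 e j -> i = j) ->
  (#|P| <= #|regular_graphs #|L| d|)%N.
Proof.
move=> eP einj.
pose h (x : 'I_#|L|) : L := enum_val x.
have hb : bijective h by exists enum_rank; [exact: enum_valK | exact: enum_rankK].
have eP' i : i \in P -> symmetric (relpre h (e i)) /\ irreflexive (relpre h (e i)).
  by case/eP => es ei _; split=> [x y|x] /=.
pose F i := rel_graph (relpre h (e i)).
rewrite -(card_in_imset (f := F)).
  apply: subset_leq_card; apply/fintype.subsetP => G /imsetP[i iP ->].
  have [es ei] := eP' i iP.
  rewrite inE; apply/forallP => x; rewrite rel_graph_degree //.
  have [_ _ /(_ (h x)) <-] := eP i iP.
  rewrite -(card_imset _ (bij_inj hb)); apply/eqP/eq_card => y; rewrite inE.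
  apply/imsetP/idP => [[z]|]; first by rewrite inE => ez ->.
  by move=> exy; exists (enum_rank y); rewrite ?inE /= /h enum_rankK.
move=> i j iP jP FE; apply: einj => // x y.
have [es ei] := eP' i iP; have [es' ei'] := eP' j jP.
have := rel_graphE es ei (enum_rank x) (enum_rank y).
by rewrite -/(F i) FE rel_graphE //= /h !enum_rankK => ->.
Qed.

(** * Circulant regular graphs *)

Section Circulant.

Lemma self_opp_ord q (x : 'I_q.+1) : x != 0 -> - x = x -> (x.*2 = q.+1)%N.
Proof.
rewrite -val_eqE /= => x0 /(congr1 val) /=; rewrite modn_small; have := ltn_ord x; lia.
Qed.

(** For odd [d] the order [q.+1] is even and the set starts from its half, the nonzero residue equal
    to its opposite; for even [d] it starts empty. Pairs [x], [- x] are then added: at least two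
    nonzero residues are still free, and by [self_opp_ord] at most one of them is its own
    opposite. *)
Lemma symmetric_set_ex q d : (d <= q)%N -> ~~ odd (d * q.+1) ->
  exists S : {set 'I_q.+1}, [/\ #|S| = d, 0 \notin S & forall t, t \in S -> - t \in S].
Proof.
rewrite -(odd_double_half d); move: (d./2) (odd d) => h b dq.
elim: h dq => [|h IH].
  rewrite double0 addn0 => bq; case: b bq => /= bq; last first.
    by move=> _; exists finset.set0; split; rewrite ?cards0 ?inE // => t; rewrite inE.
  move=> qo.
  have hq : ((q.+1)./2 < q.+1)%N by lia.
  exists [set Ordinal hq]; split; first by rewrite cards1.
    by rewrite inE -val_eqE /=; lia.
  move=> t; rewrite !inE => /eqP->; rewrite -val_eqE /= modn_small; lia.
rewrite doubleS !addnS => dq od.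
have [||S [Sd S0 SN]] := IH; first by lia.
  by move: od; rewrite !mulSn !oddD; case: (odd q.+1); case: (odd _).
have addS x : x \notin S -> x != 0 -> - x != x ->
    exists S : {set 'I_q.+1},
      [/\ #|S| = (b + h.*2).+2, 0 \notin S & forall t, t \in S -> - t \in S].
  move=> xS x0 xx; exists (x |: (- x |: S)).
  have NxS : - x \notin S by apply: contra xS => /SN; rewrite opprK.
  split.
  - by rewrite !cardsU1 !inE NxS negb_or eq_sym xx xS Sd.
  - by rewrite !inE !negb_or S0 eq_sym x0 eq_sym oppr_eq0 x0.
  - move=> t; rewrite !inE => /or3P[/eqP->|/eqP->|/SN->]; rewrite ?opprK ?eqxx ?orbT //.
have : (1 < #|~: ((0%R : 'I_q.+1) |: S)|)%N.
  have := cardsC ((0%R : 'I_q.+1) |: S); rewrite cardsU1 S0 Sd card_ord; lia.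
case/card_gt1P => x [y []]; rewrite !inE !negb_or => /andP[x0 xS] /andP[y0 yS] xy.
have [xx|xx] := eqVneq (- x) x; last exact: addS xx.
have [yy|yy] := eqVneq (- y) y; last exact: addS yy.
have := self_opp_ord x0 xx; have := self_opp_ord y0 yy => hy hx.
by move: xy; rewrite -val_eqE /=; lia.
Qed.

Lemma regular_rel_ex n d : (d < n)%N -> ~~ odd (d * n) -> exists e : rel 'I_n,
  [/\ symmetric e, irreflexive e & forall x, #|[set y | e x y]| = d].
Proof.
case: n => // q dq od; have [S [Sd S0 SN]] := @symmetric_set_ex q d dq od.
exists (fun x y => y - x \in S); split.
- move=> x y; apply/idP/idP => /SN; by rewrite opprB.
- by move=> x; rewrite subrr (negbTE S0).
- move=> x; rewrite -Sd -(card_imset _ (addIr (- x))); apply: eq_card => y.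
  apply/imsetP/idP => [[z]|yS]; first by rewrite inE => h ->.
  by exists (y + x); rewrite ?inE addrK.
Qed.
End Circulant.

(** * Lifts of the complete graph *)

Section Lift.
Variables (d N n0 : nat) (e0 : rel 'I_n0).
Local Open Scope nat_scope.
Hypotheses (es0 : symmetric e0) (ei0 : irreflexive e0)
  (ed0 : forall x, #|[set y | e0 x y]| = d).

(** One permutation for each edge of the complete graph, and the identity at all other pairs so that
    distinct indices give distinct lifts. *)
Definition lift_index :=
  pffun_on (1%g : {perm 'I_N})
    (mem [set p : 'I_d.+1 * 'I_d.+1 | p.1 < p.2]) predT.

(* The lift of the complete graph on ['I_d.+1] given by the permutations
   [f (i, j)] with [i < j], next to the graph [e0] on the leftover vertices. *)
Definition lift_rel (f : {ffun 'I_d.+1 * 'I_d.+1 -> {perm 'I_N}}) :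
    rel ('I_d.+1 * 'I_N + 'I_n0) := fun x y =>
  match x, y with
  | inl u, inl v => (u.1 < v.1) && (f (u.1, v.1) u.2 == v.2)
                    || (v.1 < u.1) && (f (v.1, u.1) v.2 == u.2)
  | inr u, inr v => e0 u v
  | _, _ => false
  end.

Lemma card_lifts : #|[set f in lift_index]| = N`! ^ 'C(d.+1, 2).
Proof.
rewrite cardsE card_pffun_on card_Sn -bin2_sum big_mkord.
congr (_ ^ _); rewrite -sum1dep_card.
rewrite -(pair_big_dep xpredT (fun i j : 'I_d.+1 => i < j) (fun _ _ => 1)) /=.
rewrite (exchange_big_dep xpredT) //=; apply: eq_bigr => j _.
by rewrite -(big_ord_widen _ (fun=> 1)) ?sum1_card ?card_ord // ltnW.
Qed.

(** A vertex over [i] has exactly one neighbour over each of the [d] other vertices [j], given by a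
    permutation or its inverse. *)
Lemma lift_rel_degree f x : #|[set y | lift_rel f x y]| = d.
Proof.
case: x => [[i a]|a]; last first.
  have inri : injective (inr : 'I_n0 -> 'I_d.+1 * 'I_N + 'I_n0) by move=> y z [].
  apply: etrans (ed0 a); rewrite -[RHS](card_imset _ inri).
  apply: eq_card => -[y|y]; rewrite !inE /=.
    by apply/esym/imsetP => -[].
  by apply/idP/imsetP => [h|[z]]; [exists y; rewrite ?inE|rewrite inE => h [->]].
pose g (j : 'I_d.+1) : 'I_d.+1 * 'I_N + 'I_n0 :=
  inl (j, if i < j then f (i, j) a else (f (j, i))^-1%g a).
have gi : injective g by move=> j k [].
apply: (@etrans _ _ #|[set~ i]|); last by rewrite cardsC1 card_ord.
rewrite -[RHS](card_imset _ gi).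
apply: eq_card => -[[j b]|b]; rewrite !inE /=; last by apply/esym/imsetP => -[].
apply/idP/imsetP => [|[k]].
  move=> h; exists j.
    by rewrite !inE -val_eqE /= neq_ltn; case/orP: h => /andP[-> _]; rewrite ?orbT.
  rewrite /g; case/orP: h => /andP[h /eqP E]; first by rewrite h E.
  by rewrite ltnNge (ltnW h) /= -E permK.
rewrite !inE => ki [-> ->]; move: ki; rewrite -val_eqE /= neq_ltn => /orP[h|h].
  by rewrite h ltnNge (ltnW h) /= permKV eqxx.
by rewrite h eqxx.
Qed.

Lemma card_regular_lift :
  N`! ^ 'C(d.+1, 2) <= #|regular_graphs (d.+1 * N + n0) d|.
Proof.
rewrite -card_lifts.
have <- : #|{: 'I_d.+1 * 'I_N + 'I_n0}| = d.+1 * N + n0.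
  by rewrite card_sum card_prod !card_ord.
apply: (card_regular_ge (e := lift_rel)) => [f _|f g].
  split; last exact: lift_rel_degree.
  - by move=> [x|x] [y|y] //=; rewrite orbC.
  - by move=> [x|x] //=; rewrite ltnn.
rewrite !inE => /pffun_onP[/supportP fS _] /pffun_onP[/supportP gS _] E.
apply/ffunP => -[i j].
have [ij|ij] := boolP (i < j); last by rewrite fS ?gS // inE.
apply/permP => a; have := E (inl (i, a)) (inl (j, f (i, j) a)).
by rewrite /= ij eqxx ltnNge (ltnW ij) /= !orbF => /esym/eqP.
Qed.
End Lift.

(** * The union bound *)

Section Estimates.
Variable R : realType.
Implicit Types (x y d : R) (n u j : nat).

(** The quotient of [j ^ j] by the factorial is one term of the series of [expR j]. *)
Lemma natrX_le_fact j : (j%:R : R) ^+ j <= expR j%:R * j`!%:R.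
Proof.
case: j => [|j]; first by rewrite expr0 expR0 mul1r.
rewrite -ler_pdivrMr ?ltr0n ?fact_gt0 //.
by apply: le_trans (expR_ge1Dxn j (ler0n _ _)); rewrite lerDr.
Qed.

Lemma bin_le_expR N j : ('C(N, j)%:R : R) <= (expR 1 * N%:R / j%:R) ^+ j.
Proof.
have [->|j0] := posnP j; first by rewrite bin0 expr0.
have jf : 0 < (j`!%:R : R) by rewrite ltr0n fact_gt0.
rewrite -(ler_pM2r jf) -natrM bin_ffact.
apply: (@le_trans _ _ (N%:R ^+ j)).
  rewrite -natrX ler_nat; elim: (j) N => [|i IH] N; first by rewrite ffactn0.
  rewrite ffactnS expnS leq_mul //; apply: leq_trans (IH _) _.
  by case: (i) => [|i'] //; rewrite leq_exp2r // leq_pred.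
have -> : (expR 1 * N%:R / j%:R) ^+ j * j`!%:R =
    N%:R ^+ j * (expR j%:R * j`!%:R / j%:R ^+ j) :> R.
  by rewrite !exprMn exprVn -expRM_natl mulr1; ring.
rewrite ler_peMr ?exprn_ge0 ?ler0n // ler_pdivlMr ?exprn_gt0 ?ltr0n //.
by rewrite mul1r natrX_le_fact.
Qed.

Lemma exprn_expR_ln x j : 0 < x -> x ^+ j = expR (j%:R * ln x).
Proof. by move=> x0; rewrite expRM_natl lnK. Qed.

Definition exponent d := (d - 2) / (2 * d - 2).

(* [ly], [ld], [S], [rho], [X] stand for the logarithms of [y], [d] and the piece
   size [s], for [r / s] and for [ln (n / (r * s))], where [r] is the bound on the
   width; the contributions of [y] to [y - S] and to [d / 2 * X] cancel. *)
Lemma per_vertex_exponent_le (K C l y d S ly ld rho X : R) : 1 <= K ->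
  l = 2 * (11 + 4 * K) + ln (32 * C) -> 0 < C -> 0 <= l ->
  1 <= y -> 2 <= d -> d <= K * y -> 0 <= ly -> ld <= d ->
  exponent d * y + ly / 2 - ld <= S -> S <= exponent d * y + ly / 2 - ld + ln 2 ->
  0 <= rho -> rho <= expR (- l) * d ^+ 2 / y ->
  X = y - (- l + ld + exponent d * y - ly / 2) - S -> 0 <= X ->
  1 + ln 2 + y - S + 4 * rho * (1 + X) + (d / 2) * (ln (16 * C) - X) <= - d.
Proof.
move=> K1 El C0 l0 y1 d2 dK ly0 ldd S1 S2 rho0 rho1 EX X0.
have ln2_1 : ln (2 : R) <= 1.
  have : ln (1 + 1 : R) <= 1 by apply: le_ln1Dx; lra.
  by rewrite (_ : 1 + 1 = 2 :> R) //; lra.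
have ln2_0 : 0 <= ln (2 : R) by apply: ln_ge0; lra.
have lnC : ln (32 * C) = ln 2 + ln (16 * C).
  by rewrite -lnM ?posrE ?mulr_gt0 //; congr ln; ring.
have y0 : 0 < y by lra.
have d1 : 0 < d - 1 by lra.
(* In terms of [t], [exponent d * y] is [(y - t) / 2] and [X] is [t + l] up to [ln 2]. As
   [t * d = t + y], the term [d / 2 * X] contains [(t + y) / 2], which is the main part of
   [y - S]. *)
set t := y / (d - 1).
have t0 : 0 <= t by rewrite divr_ge0 //; lra.
have Et : exponent d * y = y / 2 - t / 2.
  rewrite /exponent /t; field; apply/andP; split; apply: lt0r_neq0; lra.
have td : t * d = t + y.
  rewrite /t; field; apply: lt0r_neq0; lra.
have X1 : X <= t + l by rewrite EX; lra.
have X2 : t + l - ln 2 <= X by rewrite EX; lra.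
have cl : expR (- l) * (1 + l) <= 1.
  have := expR_ge1Dx l; have e0 := expR_gt0 (- l) => h.
  rewrite -[leRHS](expRxMexpNx_1 l) mulrC ler_pM2r //.
have c1 : expR (- l) <= 1 by rewrite -expR0 ler_expR; lra.
have c0 : 0 < expR (- l) := expR_gt0 _.
(* The factor [expR (- l)] absorbs [1 + l], and [d / y * t = d / (d - 1)] is at most 2. *)
have r1 : rho * (1 + X) <= K * d + 2 * d.
  apply: (@le_trans _ _ (expR (- l) * d ^+ 2 / y * (1 + l + t))).
    apply: ler_pM => //; lra.
  have -> : expR (- l) * d ^+ 2 / y * (1 + l + t) =
      (d / y) * d * (expR (- l) * (1 + l)) + d * expR (- l) * ((d / y) * t).
    field; exact: lt0r_neq0.
  have dy : d / y <= K by rewrite ler_pdivrMr.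
  have dy0 : 0 <= d / y by rewrite divr_ge0 //; lra.
  have dyt : d / y * t <= 2.
    have -> : d / y * t = d / (d - 1).
      by rewrite /t; field; apply/andP; split; apply: lt0r_neq0; lra.
    rewrite ler_pdivrMr //; lra.
  have dyt0 : 0 <= d / y * t by rewrite mulr_ge0.
  apply: lerD.
    rewrite -[leRHS]mulr1; apply: ler_pM => //; last by apply: ler_pM => //; lra.
    + by rewrite mulr_ge0 //; lra.
    + by rewrite mulr_ge0 //; lra.
  rewrite -mulrA [2 * d]mulrC; apply: ler_wpM2l; first lra.
  rewrite -[leRHS]mul1r; apply: ler_pM => //; lra.
have : (d / 2) * (ln (16 * C) - X) <= (d / 2) * (ln (32 * C) - t - l).
  by apply: ler_wpM2l; lra.
have -> : (d / 2) * (ln (32 * C) - t - l) = d / 2 * (ln (32 * C) - l) - (t + y) / 2.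
  by rewrite -td; field.
(* The costs [1 + ln 2 <= d], [ld <= d] and [4 * rho * (1 + X) <= (8 + 4 * K) * d] add up to
   [(10 + 4 * K) * d], one [d] less than the gain that [l] provides. *)
have -> : ln (32 * C) - l = - 2 * (11 + 4 * K) by rewrite El; ring.
nra.
Qed.

End Estimates.

(** Its product with [tww_bound n d] is [n ^ ((d - 2) / (d - 1))], without logarithms, and the
    quotient of [tww_bound n d] by it is [d ^ 2 / ln n], of order at most [d] when
    [d <= K * ln n]. *)
Definition piece_size (R : realType) (n : nat) (d : R) : R :=
  Num.sqrt (ln n%:R) / d * n%:R `^ exponent d.

Section UnionBound.
(* [expR (- l)] plays the role of the constant of the theorem. *)
Variables (R : realType) (K C l : R).
Hypotheses (K1 : 1 <= K) (C1 : 1 <= C) (El : l = 2 * (11 + 4 * K) + ln (32 * C)).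

Lemma ln_inv_c_ge1 : 1 <= l.
Proof.
have h := C1; have h2 : 1 <= 32 * C by lra.
have := ln_ge0 h2; have := K1; rewrite El; lra.
Qed.

(** The first factors count vertex sets, piece maps and sets of pairs of pieces. The power bounds
    the proportion of graphs with [e] edges in one hull, with [C] depending on the random model.
    Each factor is at most the exponential of a multiple of [u] or [e], and [per_vertex_exponent_le]
    adds up the exponents. *)
Lemma union_bound_le (n u e s w : nat) (d : R) :
  1 <= ln (n%:R : R) -> 2 <= d -> d <= K * ln n%:R ->
  piece_size n d <= s%:R -> s%:R <= 2 * piece_size n d ->
  1 <= expR (- l) * tww_bound n d -> w%:R <= expR (- l) * tww_bound n d ->
  (0 < s <= u)%N -> (u <= n)%N -> 2 * e%:R = d * u%:R ->
  ('C(n, u) * (u %/ s).+1 ^ u *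
     #|[set Q : {set 'I_(u %/ s).+1 * 'I_(u %/ s).+1} |
          (#|Q| <= (u %/ s).+1 * w.+1)%N]|)%:R
  * (C * ((u %/ s).+1 * w.+1 * (2 * s) ^ 2)%:R / (u%:R * n%:R)) ^+ e
    <= expR (- (d * u%:R)).
Proof.
move=> y1 d2 dK sl su r1 wr /andP[s0 su_] un Ee.
set y := ln n%:R in y1 dK; set r := expR (- l) * _ in r1 wr.
have l1 := ln_inv_c_ge1; have hC := C1.
have u0 : (0 < u)%N := leq_trans s0 su_.
have n0 : (0 < n)%N := leq_trans u0 un.
have y0 : 0 < y by lra.
have d0 : 0 < d by lra.
have uR : 0 < (u%:R : R) by rewrite ltr0n.
have nR : 0 < (n%:R : R) by rewrite ltr0n.
have sR : 0 < (s%:R : R) by rewrite ltr0n.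
have usR : (s%:R : R) <= u%:R by rewrite ler_nat.
have unR : (u%:R : R) <= n%:R by rewrite ler_nat.
set sg := piece_size n d in sl su.
have sy0 : 0 < Num.sqrt y by rewrite sqrtr_gt0.
have a0 : 0 < n%:R `^ exponent d :> R by rewrite powR_gt0.
have sg0 : 0 < sg by rewrite mulr_gt0 // divr_gt0.
have lsy : ln (Num.sqrt y) = ln y / 2.
  by rewrite -powR12_sqrt ?ltW // ln_powR mulrC.
have lsg : ln sg = exponent d * y + ln y / 2 - ln d.
  by rewrite /sg /piece_size !lnM ?posrE ?divr_gt0 ?invr_gt0 // lnV ?posrE // ln_powR lsy /y; ring.
have r0 : 0 < r by lra.
have lr : ln r = - l + ln d + exponent d * y - ln y / 2.
  rewrite /r /tww_bound -/y -/(exponent d) !lnM ?posrE ?mulr_gt0 ?divr_gt0 ?invr_gt0 ?expR_gt0 //.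
  by rewrite expRK lnV ?posrE // ln_powR lsy /y; ring.
set S := ln (s%:R : R).
have S1 : ln sg <= S by rewrite ler_ln ?posrE.
have S2 : S <= ln sg + ln 2.
  have -> : ln sg + ln 2 = ln (2 * sg) by rewrite lnM ?posrE // addrC.
  by rewrite /S ler_ln ?posrE // mulr_gt0 // ltr0n.
set X := y - ln r - S.
set rho := r / s%:R.
have rho0 : 0 <= rho by rewrite divr_ge0 // ltW.
have rhoE : rho <= expR (- l) * d ^+ 2 / y.
  apply: (@le_trans _ _ (r / sg)).
    by rewrite /rho; apply: ler_wpM2l; [exact: ltW | rewrite lef_pV2 ?posrE].
  rewrite /r /tww_bound /sg /piece_size -/y -/(exponent d).
  rewrite [leRHS](_ : _ = expR (- l) * d ^+ 2 / Num.sqrt y ^+ 2); last by rewrite sqr_sqrtr // ltW.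
  by rewrite le_eqVlt; apply/orP; left; apply/eqP; field; rewrite !lt0r_neq0.
have ldd : ln d <= d.
  have := @le_ln1Dx R (d - 1); rewrite (_ : 1 + (d - 1) = d); [lra|ring].
have ly0 : 0 <= ln y by apply: ln_ge0.
have ln2_1 : ln (2 : R) <= 1.
  have : ln (1 + 1 : R) <= 1 by apply: le_ln1Dx; lra.
  by rewrite (_ : 1 + 1 = 2 :> R) //; lra.
have X0 : 0 <= X.
  rewrite /X lr; have : exponent d * y * 2 <= y.
    rewrite mulrAC -[leRHS]mul1r ler_pM2r // /exponent mulrAC ler_pdivrMr; lra.
  by move: S2; rewrite lsg; lra.
set k := (u %/ s)%N; set q := (k.+1 * w.+1)%N.
have kR : (k.+1%:R : R) <= 2 * u%:R / s%:R.
  rewrite ler_pdivlMr // -natrM -natrM ler_nat mulSn.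
  by rewrite mul2n -addnn leq_add // leq_trunc_div.
have wR : (w.+1%:R : R) <= 2 * r by rewrite -natr1; lra.
have qR : (q%:R : R) <= u%:R * (4 * rho).
  rewrite /q natrM (_ : u%:R * _ = (2 * u%:R / s%:R) * (2 * r)); last by rewrite /rho; ring.
  by apply: ler_pM.
have EX : expR (- X) = r * s%:R / n%:R.
  rewrite /X opprB opprB addrA addrAC expRD expRD expRN !lnK ?posrE //; ring.
have F1 : ('C(n, u)%:R : R) <= expR (u%:R * (1 + y - ln u%:R)).
  apply: le_trans (bin_le_expR _ _ _) _.
  rewrite exprn_expR_ln ?divr_gt0 ?mulr_gt0 ?expR_gt0 //.
  by rewrite !lnM ?posrE ?mulr_gt0 ?invr_gt0 ?expR_gt0 // expRK lnV ?posrE.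
have F2 : ((k.+1 ^ u)%:R : R) <= expR (u%:R * (ln 2 + ln u%:R - S)).
  rewrite natrX; apply: (@le_trans _ _ ((2 * u%:R / s%:R) ^+ u)).
    by rewrite lerXn2r ?nnegrE ?ler0n // ltW // divr_gt0 ?mulr_gt0.
  rewrite exprn_expR_ln ?divr_gt0 ?mulr_gt0 //.
  by rewrite !lnM ?posrE ?mulr_gt0 ?invr_gt0 // lnV ?posrE.
have F3 : (#|[set Q : {set 'I_k.+1 * 'I_k.+1} | (#|Q| <= q)%N]|%:R : R)
    <= expR (u%:R * (4 * rho * (1 + X))).
  (* The weight [expR (- X)] is [r * s / n]. There are at most [(2 * u / s) ^ 2] pairs of pieces, so
     the exponential on the right costs at most [4 * rho * u], and dividing by the [q]-th power of
     the weight costs [q * X]. *)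
  have := @card_small_sets R ('I_k.+1 * 'I_k.+1)%type q (expR (- X)) (expR_ge0 _).
  rewrite -expR0 ler_expR expR0 oppr_le0 => /(_ X0).
  rewrite -expRM_natl -ler_pdivlMr ?expR_gt0 // -expRN -expRD => h.
  apply: le_trans h _; rewrite ler_expR card_prod card_ord natrM mulrDr mulr1 mulrDr.
  apply: lerD; last first.
    by rewrite mulrN opprK mulrA; apply: ler_wpM2r.
  rewrite EX; apply: (@le_trans _ _ (r * s%:R / n%:R * ((2 * u%:R / s%:R) * (2 * u%:R / s%:R)))).
    by apply: ler_wpM2l; [rewrite divr_ge0 ?mulr_ge0 // ltW | apply: ler_pM].
  rewrite (_ : r * _ / _ * _ = u%:R * (4 * rho) * (u%:R / n%:R)); last first.
    by rewrite /rho; field; rewrite !lt0r_neq0.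
  by rewrite ler_piMr ?ler_pdivrMr ?mul1r // ?mulr_ge0 // ltW.
have F4 : (C * (q * (2 * s) ^ 2)%:R / (u%:R * n%:R)) ^+ e
    <= expR (e%:R * (ln (16 * C) - X)).
  have C0 : 0 < 16 * C by lra.
  have base0 : 0 <= C * (q * (2 * s) ^ 2)%:R / (u%:R * n%:R).
    by rewrite divr_ge0 ?mulr_ge0 ?ler0n //; lra.
  rewrite expRM_natl expRD lnK ?posrE // EX.
  have rhs0 : 0 <= 16 * C * (r * s%:R / n%:R).
    by apply: mulr_ge0; [exact: ltW | rewrite divr_ge0 ?mulr_ge0 // ltW].
  apply: lerXn2r; rewrite ?nnegrE //.
  have -> : ((q * (2 * s) ^ 2)%:R : R) = q%:R * (4 * s%:R ^+ 2).
    by rewrite natrM expnS expn1 !natrM; ring.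
  rewrite (_ : _ / (u%:R * n%:R) =
     (C * 4 * s%:R ^+ 2 / (u%:R * n%:R)) * q%:R); last by ring.
  rewrite (_ : 16 * C * _ = (C * 4 * s%:R ^+ 2 / (u%:R * n%:R)) * (u%:R * (4 * rho))).
    by apply: ler_wpM2l => //; rewrite divr_ge0 ?mulr_ge0 ?exprn_ge0 ?ler0n //; lra.
  by rewrite /rho; field; rewrite !lt0r_neq0.
have psi := @per_vertex_exponent_le R K C l y d S (ln y) (ln d) rho X K1 El ltac:(lra) ltac:(lra)
  y1 d2 dK ly0 ldd ltac:(lra) ltac:(lra) rho0 rhoE ltac:(rewrite /X lr; ring) X0.
rewrite !natrM.
apply: (@le_trans _ _ (expR (u%:R * (1 + y - ln u%:R)) * expR (u%:R * (ln 2 + ln u%:R - S))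
   * expR (u%:R * (4 * rho * (1 + X))) * expR (e%:R * (ln (16 * C) - X)))).
  apply: ler_pM => //.
  - by rewrite exprn_ge0 // divr_ge0 ?mulr_ge0 ?ler0n //; lra.
  - by apply: ler_pM => //; apply: ler_pM.
  - by move: F4; rewrite /q !natrM.
rewrite -!expRD ler_expR.
have -> : e%:R = u%:R * (d / 2) by move: Ee; lra.
have := ler_wpM2l (ltW uR) psi; lra.
Qed.

End UnionBound.

(** * Estimates for large n *)

Section Large.
Variable R : realType.

Lemma ln_large (B : R) : exists n0 : nat, forall n, (n0 <= n)%N -> B <= ln (n%:R : R).
Proof.
exists (Num.truncn (expR B)).+1 => n nB.
have h : expR B <= n%:R.
  by apply: ltW; apply: lt_le_trans (truncnS_gt _) _; rewrite ler_nat.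
by rewrite -(expRK B) ler_ln ?posrE ?expR_gt0 // (lt_le_trans (expR_gt0 _) h).
Qed.

Lemma natr_expR_ln n : 0 < ln (n%:R : R) -> (n%:R : R) = expR (ln n%:R).
Proof. by move=> y0; rewrite lnK // posrE ltNge; apply: contraTN y0 => h; rewrite ln0 // ltxx. Qed.

Lemma powR_expR_ln n (t : R) : 0 < ln (n%:R : R) -> n%:R `^ t = expR (t * ln n%:R).
Proof. by move=> y0; rewrite {1}(natr_expR_ln y0) -expRM mulrC. Qed.

(** The cubic term [(t * y) ^ 3 / 6] of the series already suffices. *)
Lemma expR_ge_sqr (A t y : R) : 0 < t -> 0 <= A -> 0 <= y -> 6 * A / t ^+ 3 <= y ->
  A * y ^+ 2 <= expR (t * y).
Proof.
move=> t0 A0 y0; rewrite ler_pdivrMr ?exprn_gt0 // => h.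
have ty : 0 <= t * y by rewrite mulr_ge0 // ltW.
have := expR_ge1Dxn 2 ty.
have -> : (3`!)%:R = 6 :> R by [].
have : A * y ^+ 2 <= (t * y) ^+ 3 / 6.
  rewrite ler_pdivlMr //.
  have -> : (t * y) ^+ 3 = y ^+ 2 * (y * t ^+ 3) by ring.
  have -> : A * y ^+ 2 * 6 = y ^+ 2 * (6 * A) by ring.
  by apply: ler_wpM2l => //; rewrite exprn_ge0.
move=> h1 h2; apply: le_trans h1 _; apply: le_trans h2; by rewrite lerDr.
Qed.

Lemma exponent_ge (eps d : R) : 0 < eps -> 2 + 2 * eps <= d ->
  eps / (1 + 2 * eps) <= exponent d.
Proof.
move=> e0 de; rewrite /exponent ler_pdivlMr; last lra.
rewrite mulrAC ler_pdivrMr; lra.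
Qed.

Lemma exponent_le (d : R) : 2 <= d -> exponent d <= 1 / 2.
Proof. move=> d2; rewrite /exponent ler_pdivrMr; lra. Qed.

(** The lower bound [t] on the exponent replaces [d] in the largeness hypotheses, so that one
    threshold on [n] serves all [d]. The conclusions put [s] above the maximum degree [K * y] and
    below the size of [U]. *)
Lemma sizes_large (K c t y d : R) n : y = ln n%:R -> 1 <= K -> 0 < c -> c <= 1 ->
  1 <= y -> 2 <= d -> d <= K * y -> t <= exponent d ->
  (K ^+ 2 / c) * y ^+ 2 <= expR (t * y) -> y ^+ 2 <= expR y ->
  let s := (Num.truncn (piece_size n d)).+1 in
  [/\ piece_size n d <= s%:R, s%:R <= 2 * piece_size n d, K * y < s%:R,
      1 <= c * tww_bound n d & (s%:R : R) <= (n%:R : R) `^ (3 / 4)].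
Proof.
move=> Ey K1 c0 c1 y1 d2 dK td hA hy s.
have y0 : 0 < y by lra.
have K0 : 0 < K by lra.
have d0 : 0 < d by lra.
have sy0 : 0 < Num.sqrt y by rewrite sqrtr_gt0.
have sy1 : 1 <= Num.sqrt y by rewrite -[1]sqrtr1; exact: ler_wsqrtr.
have sq : Num.sqrt y ^+ 2 = y by rewrite sqr_sqrtr // ltW.
have syy : Num.sqrt y <= y by rewrite -{2}sq expr2 ler_peMl // ltW.
have hn : n%:R `^ exponent d = expR (exponent d * y).
  by rewrite Ey powR_expR_ln // -Ey.
have big : (K ^+ 2 / c) * y ^+ 2 <= n%:R `^ exponent d.
  by rewrite hn; apply: le_trans hA _; rewrite ler_expR ler_wpM2r // ltW.
have K2c : K ^+ 2 <= K ^+ 2 / c.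
  by rewrite ler_pdivlMr // ler_piMr // exprn_ge0 // ltW.
have psK : K * y <= piece_size n d.
  rewrite /piece_size -Ey mulrAC ler_pdivlMr //.
  apply: (@le_trans _ _ (1 * (K ^+ 2 * y ^+ 2))).
    rewrite mul1r -exprMn expr2; apply: ler_wpM2l => //; rewrite mulr_ge0 //; exact: ltW.
  apply: ler_pM => //; first by rewrite mulr_ge0 // exprn_ge0 // ltW.
  by apply: le_trans big; apply: ler_wpM2r => //; rewrite exprn_ge0 // ltW.
have ps1 : 1 <= piece_size n d by apply: le_trans psK; rewrite -[1]mulr1; apply: ler_pM.
have ps0 : 0 <= piece_size n d by lra.
have h1 : piece_size n d < s%:R := truncnS_gt _.
have h2 : s%:R <= 2 * piece_size n d.
  rewrite /s -natr1; have : (Num.truncn (piece_size n d))%:R <= piece_size n d by rewrite truncn_le.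
  lra.
split=> //; first exact: ltW.
- exact: le_lt_trans psK h1.
- rewrite /tww_bound -Ey -/(exponent d).
  rewrite mulrA mulrAC; apply: (@le_trans _ _ (c * (K ^+ 2 / c * y ^+ 2) * (d / Num.sqrt y))).
    have -> : c * (K ^+ 2 / c * y ^+ 2) * (d / Num.sqrt y) = K ^+ 2 * (d * (y * (y / Num.sqrt y))).
      by field; rewrite !lt0r_neq0.
    have y2 : 1 <= y / Num.sqrt y by rewrite ler_pdivlMr // mul1r.
    rewrite -[1]mulr1; apply: ler_pM => //; first by rewrite expr_ge1 // ltW.
    rewrite -[1]mulr1; apply: ler_pM => //; first lra.
    by rewrite -[1]mulr1; apply: ler_pM.
  apply: ler_wpM2r; first by rewrite divr_ge0 // ltW.
  by apply: ler_wpM2l big; rewrite ltW.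
apply: le_trans h2 _; rewrite /piece_size -Ey hn powR_expR_ln -?Ey //.
have -> : 2 * (Num.sqrt y / d * expR (exponent d * y)) =
    (2 / d) * (Num.sqrt y * expR (exponent d * y)) by field; rewrite lt0r_neq0.
apply: (@le_trans _ _ (1 * (expR (y / 4) * expR (1 / 2 * y)))); last first.
  rewrite mul1r -expRD ler_expR; lra.
apply: ler_pM => //.
- by rewrite divr_ge0 // ltW.
- by rewrite ler_pdivrMr // mul1r.
apply: ler_pM => //; rewrite ?expR_ge0 //; last first.
  by rewrite ler_expR ler_wpM2r ?exponent_le // ltW.
(* Fourth powers reduce [Num.sqrt y <= expR (y / 4)] to [y ^+ 2 <= expR y]; this is the 1/4 in 3/4 =
   1/4 + 1/2. *)
rewrite -(@ler_pXn2r _ 4) ?nnegrE ?expR_ge0 // -expRM_natl.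
rewrite (_ : 4 * (y / 4) = y); last by field.
by rewrite (exprM _ 2 2) sq.
Qed.

(** The lifts with fibres of size [N >= n / (4 * d)] are counted with the factorial bound
    [(N / expR 1) ^ N]. One factor [expR 1] comes from this bound, the other pays for the leftover
    vertices. *)
Lemma regular_graphs_ge n d e : (0 < d)%N -> (2 * e = d * n)%N ->
  1 <= ln (n%:R : R) -> (2 * d + 1)%:R * ln (n%:R : R) <= n%:R ->
  (4 * d + 2 <= n)%N ->
  (n%:R / (4 * expR 2 * d%:R)) ^+ e <= (#|regular_graphs n d|%:R : R).
Proof.
move=> d0 Ee y1 nd nd2.
set y := ln n%:R in y1 nd.
(* Removing [d.+1] first leaves [d < n0 <= 2 * d + 1], enough vertices for a circulant; [d * n0] is
   even because [d * d.+1 * N] is. *)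
pose N := ((n - d.+1) %/ d.+1)%N; pose n0 := (n - d.+1 * N)%N.
have hN : (N * d.+1 <= n - d.+1)%N := leq_trunc_div _ _.
have hN2 : (n - d.+1 < N.+1 * d.+1)%N by apply: ltn_ceil.
have En : n = (d.+1 * N + n0)%N by rewrite /n0; lia.
have n0d : (d < n0)%N by rewrite /n0; lia.
have n0d2 : (n0 <= 2 * d + 1)%N by rewrite /n0; lia.
have od : ~~ odd (d * n0).
  have : odd (d * n) = odd (d * n0).
    by rewrite {1}En mulnDr oddD mulnA !oddM /=; case: (odd d) => //=.
  by move=> <-; rewrite -Ee oddM.
have [r [rs ri rd]] := regular_rel_ex n0d od.
have := @card_regular_lift d N n0 r rs ri rd; rewrite -En => cnt.
apply: (@le_trans _ _ ((N`! ^ 'C(d.+1, 2))%:R)); last by rewrite ler_nat.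
have N0 : (0 < N)%N by nia.
have NR : 0 < (N%:R : R) by rewrite ltr0n.
have nR : 0 < (n%:R : R) by rewrite ltr0n; lia.
have dR : 0 < (d%:R : R) by rewrite ltr0n.
have fN : expR (N%:R * (ln N%:R - 1)) <= (N`!%:R : R).
  have := natrX_le_fact R N; rewrite exprn_expR_ln // [expR _ * _]mulrC -ler_pdivrMr ?expR_gt0 //.
  by rewrite -expRN -expRD mulrBr mulr1.
rewrite natrX; apply: (@le_trans _ _ (expR (N%:R * (ln N%:R - 1)) ^+ 'C(d.+1, 2))); last first.
  by apply: lerXn2r; rewrite ?nnegrE ?expR_ge0 ?ler0n.
have e2 : 0 < expR (2 : R) by rewrite expR_gt0.
rewrite -expRM_natl exprn_expR_ln ?divr_gt0 ?mulr_gt0 // ler_expR.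
rewrite lnM ?posrE ?invr_gt0 ?mulr_gt0 // lnV ?posrE ?mulr_gt0 // !lnM ?posrE ?mulr_gt0 // expRK.
have hbin : ('C(d.+1, 2)%:R * N%:R : R) = d%:R / 2 * (n%:R - n0%:R).
  have : (2 * 'C(d.+1, 2) = d.+1 * d)%N by rewrite bin2 /= mul2n; have := odd_double_half (d.+1 * d); rewrite oddM /=; case: (odd d).
  move/(congr1 (fun z => z%:R : R)); rewrite !natrM => h.
  have : (n%:R : R) = d.+1%:R * N%:R + n0%:R by rewrite {1}En natrD natrM.
  move=> ->; move: h; nra.
have eR : (e%:R : R) = d%:R * n%:R / 2.
  by have := congr1 (fun z => z%:R : R) Ee; rewrite !natrM; lra.
rewrite mulrA hbin eR.
have lN : y - ln d%:R - ln 4 <= ln N%:R.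
  have : (n%:R / (d%:R * 4) : R) <= N%:R.
    rewrite ler_pdivrMr ?mulr_gt0 // -!natrM ler_nat; nia.
  rewrite -ler_ln ?posrE ?divr_gt0 ?mulr_gt0 // lnM ?posrE ?invr_gt0 ?mulr_gt0 //.
  by rewrite lnV ?posrE ?mulr_gt0 // lnM ?posrE // -/y; lra.
(* Omitting [n0] vertices loses at most a factor [n ^ (d * n0 / 2)], which is at most
   [expR (d * n / 2)]. *)
have n0R : (n0%:R : R) * y <= n%:R.
  apply: le_trans nd; apply: ler_wpM2r; [lra|by rewrite ler_nat].
have ld0 : 0 <= ln (d%:R : R) by apply: ln_ge0; rewrite ler1n.
have l40 : 0 <= ln (4 : R) by apply: ln_ge0; lra.
have nn0 : (n0%:R : R) <= n%:R by rewrite ler_nat leq_subr.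
have n00 : 0 <= (n0%:R : R) by rewrite ler0n.
rewrite -/y.
have -> : d%:R * n%:R / 2 * (y - (ln 4 + 2 + ln d%:R)) =
  d%:R / 2 * (n%:R * (y - (ln 4 + 2 + ln d%:R))) by field.
rewrite -[leRHS]mulrA; apply: ler_wpM2l; first lra.
apply: (@le_trans _ _ ((n%:R - n0%:R) * (y - ln d%:R - ln 4 - 1))); last first.
  apply: ler_wpM2l; lra.
have : 0 <= (n0%:R : R) * (ln d%:R + ln 4 + 1) by apply: mulr_ge0 => //; lra.
lra.
Qed.

End Large.

(** * From limits to counts of bad graphs *)

Lemma tends_to_one_alongP (R : realType) (S : nat -> Prop) (p : nat -> R) :
  (forall n, p n <= 1) ->
  (forall delta, 0 < delta -> exists n0, forall n, (n0 <= n)%N -> S n -> 1 - delta <= p n) ->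
  tends_to_one_along S p.
Proof.
move=> p1 h; apply/cvgrPdist_le => e e0; have [n0 hn0] := h e e0.
rewrite near_withinE; exists n0 => // n nn0 Sn.
by rewrite ger0_norm ?subr_ge0 // lerBlDr addrC -lerBlDr hn0.
Qed.

Section Prob.
Variables (R : realType) (U : finType) (Omega : {set U}) (A : pred U).

Lemma prob_uniform_le1 : prob_uniform R Omega A <= 1.
Proof.
rewrite /prob_uniform; have [->|O0] := posnP #|Omega|; first by rewrite invr0 mulr0.
rewrite ler_pdivrMr ?ltr0n // mul1r ler_nat; apply: subset_leq_card.
by apply/fintype.subsetP => x; rewrite inE => /andP[].
Qed.

Lemma prob_uniform_ge (delta : R) : (0 < #|Omega|)%N ->
  #|[set G in Omega | ~~ A G]|%:R <= delta * #|Omega|%:R ->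
  1 - delta <= prob_uniform R Omega A.
Proof.
move=> O0 h; rewrite /prob_uniform ler_pdivlMr ?ltr0n // mulrBl mul1r.
rewrite lerBlDr; apply: le_trans (_ : _ <= #|[set G in Omega | A G]|%:R + #|[set G in Omega | ~~ A G]|%:R) _; last by rewrite lerD2l.
rewrite -natrD ler_nat -(cardsID [set G | A G] Omega); apply: leq_add;
  apply: subset_leq_card; apply/fintype.subsetP => x; rewrite !inE //.
by rewrite andbC.
Qed.
End Prob.

Lemma handshake (T : finType) (U : {set T}) (F : {set {set T}}) : F \subset pairs U ->
  (\sum_(x in U) #|[set e in F | x \in e]| = 2 * #|F|)%N.
Proof.
move=> FU; under eq_bigr => x _ do rewrite -sum1dep_card.
rewrite (exchange_big_dep (fun e => e \in F)) /=; last by move=> x e _ /andP[].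
rewrite mulnC -sum_nat_const; apply: eq_bigr => e eF.
have := fintype.subsetP FU _ eF; rewrite inE => /andP[eU /eqP <-].
rewrite -sum1_card; apply: eq_bigl => x; rewrite eF /=.
by case xe: (x \in e); rewrite ?andbF // (fintype.subsetP eU).
Qed.

Lemma tww_at_most_le (T : finType) (G : sgraph T) w w' :
  (w <= w')%N -> tww_at_most G w -> tww_at_most G w'.
Proof.
move=> ww [k [S [S0 Sc S1 Sr]]]; exists k, S; split=> // i x ik xS.
exact: leq_trans (Sr i x ik xS) ww.
Qed.

Lemma tww_at_most_truncn (R : realType) (T : finType) (G : sgraph T) (r : R) :
  (0 < #|T|)%N -> (tww G)%:R < r -> tww_at_most G (Num.truncn r).
Proof.
move=> T0 Gr; apply: tww_at_most_le (proj1 (twwP G T0)).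
by rewrite truncn_ge_nat ?ltW // (le_lt_trans (ler0n _ _) Gr).
Qed.

Lemma card_subgraphs (T : finType) (P : {set {set T}}) e :
  (#|[set G : sgraph T | (edges G \subset P) && (#|edges G| == e)]| <= 'C(#|P|, e))%N.
Proof.
rewrite (card_graphs (fun E => (E \subset P) && (#|E| == e))) -cards_draws.
apply: subset_leq_card; apply/fintype.subsetP => E; rewrite !inE => /and3P[_ -> ->].
by [].
Qed.

(** * Regular graphs *)

Section Regular.
Variable R : realType.
(* The factor [4 * expR 2] of [regular_graphs_ge] times the factor [2 * expR 1] in
   ['C(M, e) <= (2 * expR 1 * M / (d * n)) ^+ e], where [2 * e = d * n]. *)
Let C : R := 8 * expR 3.
Let l : R := 2 * (11 + 4 * 1) + ln (32 * C).
Let c : R := expR (- l).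

(** All [d * n / 2] edges of a bad graph lie in one hull of the whole vertex set. Regularity is then
    dropped: all graphs with that many edges inside a hull are counted and compared with
    [regular_graphs_ge]. *)
Lemma regular_bad (n d : nat) (d2 : (2 < d)%N) : ~~ odd (d * n) ->
  (d%:R : R) <= 5^-1 * ln n%:R -> 6 <= ln (n%:R : R) ->
  c^-1 * (ln (n%:R : R)) ^+ 2 <= expR (1 / 4 * ln n%:R) ->
  (0 < #|regular_graphs n d|)%N /\
  (#|[set G in regular_graphs n d | ~~ (c * tww_bound n (d%:R : R) <= (tww G)%:R)]|%:R : R)
   <= expR (- n%:R) * #|regular_graphs n d|%:R.
Proof.
move=> od dy y6 hA.
have C1 : 1 <= C by rewrite /C; have := expR_ge1Dx (3 : R); lra.
have El : l = 2 * (11 + 4 * 1) + ln (32 * C) by [].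
have l1 : 1 <= l := ln_inv_c_ge1 (lexx 1) C1 El.
set y := ln n%:R in dy y6 hA.
have y0 : 0 < y by lra.
have en : n%:R = expR y by rewrite natr_expR_ln.
have c0 : 0 < c := expR_gt0 _.
have c1 : c <= 1 by rewrite -expR0 ler_expR; lra.
have nR : 0 < (n%:R : R) by rewrite en expR_gt0.
have n0 : (0 < n)%N by rewrite -(ltr0n R).
have y2 : y ^+ 2 <= expR (1 / 4 * y).
  apply: le_trans hA; rewrite ler_peMl ?exprn_ge0 ?(ltW y0) //.
  by rewrite invf_ge1.
have yn : y ^+ 2 <= n%:R.
  apply: le_trans y2 _; rewrite en ler_expR; lra.
have dR : (3 : R) <= d%:R by rewrite ler_nat.
pose e := (d * n)./2.
have Ee : (2 * e = d * n)%N by rewrite mul2n /e; have := odd_double_half (d * n); rewrite (negbTE od).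
have dn5 : (4 * d + 2 <= n)%N.
  by rewrite -(ler_nat R) natrD natrM; nra.
have regge : (n%:R / (4 * expR 2 * d%:R)) ^+ e <= (#|regular_graphs n d|%:R : R).
  have d0 : (0 < d)%N := ltn_trans (isT : (0 < 2)%N) d2.
  apply: regular_graphs_ge => //; first by rewrite -/y; lra.
  apply: le_trans yn; rewrite expr2 -/y; apply: ler_wpM2r; first exact: ltW.
  by rewrite natrD natrM; lra.
have reg0 : (0 < #|regular_graphs n d|)%N.
  rewrite -(ltr0n R); apply: lt_le_trans regge.
  by rewrite exprn_gt0 // divr_gt0 // !mulr_gt0 ?expR_gt0 //; lra.
split=> //.
(* The value of the exponent at [d = 3]. *)
have th : 1 / 4 <= exponent (d%:R : R).
  have := @exponent_ge R (1 / 2) d%:R ltac:(lra) ltac:(lra).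
  by rewrite (_ : 1 / 2 / (1 + 2 * (1 / 2)) = 1 / 4 :> R) //; field.
have [s1 s2 s3 r1 sn] := @sizes_large R 1 c (1 / 4) y d%:R n erefl (lexx 1) c0 c1
  ltac:(lra) ltac:(lra) ltac:(lra) th
  ltac:(rewrite expr1n (div1r c); exact: hA) ltac:(rewrite -en; exact: yn).
set s := (Num.truncn _).+1 in s1 s2 s3 sn.
set r := c * _ in r1 *.
pose w := Num.truncn r.
have wr : w%:R <= r by rewrite truncn_le; lra.
have sn' : (s <= n)%N.
  rewrite -(ler_nat R); apply: le_trans sn _; rewrite powR_expR_ln // -/y en ler_expR; lra.
have ut := union_bound_le (lexx 1) C1 El (n := n) (u := n) (e := e) (s := s) (w := w) (d := d%:R)
  ltac:(rewrite -/y; lra) ltac:(lra) ltac:(rewrite -/y; lra) s1 s2 r1 wr ltac:(by rewrite sn')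
  (leqnn n) ltac:(by rewrite -!natrM Ee).
set k := (n %/ s)%N in ut.
set q := (k.+1 * w.+1)%N in ut.
pose Hs := hulls [set: 'I_n] k q ((2 * s) ^ 2).
have bad_sub : [set G in regular_graphs n d | ~~ (r <= (tww G)%:R)] \subset
    \bigcup_(P in Hs) [set G : sgraph 'I_n | (edges G \subset P) && (#|edges G| == e)].
  apply/fintype.subsetP => G; rewrite inE -ltNge => /andP[Greg Gr].
  have degG x : degree G x = d by move: Greg; rewrite inE => /forallP/(_ x)/eqP.
  have dG x : (degree G x < s)%N.
    by rewrite degG -(ltr_nat R); apply: le_lt_trans s3; lra.
  have tG : tww_at_most G w by apply: tww_at_most_truncn => //; rewrite card_ord.
  have := @hulls_cover _ G [set: 'I_n] w s _ dG tG.
  rewrite cardsT card_ord => -[|P PH sub].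
    by rewrite -(ltr_nat R); apply: le_lt_trans s3; lra.
  apply/bigcupP; exists P => //; rewrite inE; apply/andP; split.
    apply: fintype.subset_trans sub; rewrite finset.subsetI fintype.subxx /=; exact: edges_sub.
  have := handshake (edges_sub G); rewrite (eq_bigr (fun=> d)); last first.
    by move=> x _; apply: degG.
  by rewrite sum_nat_const cardsT card_ord mulnC -Ee => /eqP; rewrite eqn_pmul2l // eq_sym.
apply: (@le_trans _ _ (#|Hs|%:R * 'C(q * (2 * s) ^ 2, e)%:R)).
  rewrite -natrM ler_nat; apply: leq_trans (subset_leq_card bad_sub) _.
  apply: leq_trans (leq_card_bigcup _ _) _; rewrite -sum_nat_const; apply: leq_sum => P.
  rewrite inE => /andP[_ PM]; apply: leq_trans (card_subgraphs _ _) _.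
  exact: leq_bin2l.
set M := (q * (2 * s) ^ 2)%N in ut *.
have CM : 'C(M, e)%:R <= (C * M%:R / (n%:R * n%:R)) ^+ e * #|regular_graphs n d|%:R.
  apply: le_trans (bin_le_expR _ _ _) _.
  apply: le_trans (ler_wpM2l _ regge); last first.
    by rewrite exprn_ge0 // divr_ge0 ?mulr_ge0 ?ler0n //; lra.
  have eR : (e%:R : R) = d%:R * n%:R / 2.
    by have := congr1 (fun z => z%:R : R) Ee; rewrite !natrM; lra.
  rewrite -exprMn eR le_eqVlt; apply/orP; left; apply/eqP; congr (_ ^+ _).
  rewrite /C (_ : 3 = 1 + 2); last by lra.
  rewrite expRD; field; rewrite !lt0r_neq0 ?expR_gt0 //; lra.
apply: (@le_trans _ _ (#|Hs|%:R * ((C * M%:R / (n%:R * n%:R)) ^+ e * #|regular_graphs n d|%:R))).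
  by apply: ler_wpM2l.
rewrite mulrA; apply: ler_wpM2r; first exact: ler0n.
apply: le_trans (_ : _ <= expR (- (d%:R * n%:R))) _; last first.
  by rewrite ler_expR lerN2 ler_peMl //; lra.
apply: le_trans ut; apply: ler_wpM2r.
  by rewrite exprn_ge0 // divr_ge0 ?mulr_ge0 ?ler0n //; lra.
rewrite ler_nat binn mul1n; have := card_hulls [set: 'I_n] k q ((2 * s) ^ 2).
by rewrite cardsT card_ord.
Qed.

Lemma regular_part : exists c : R, 0 < c /\
     forall d : nat -> nat,
       tends_to_one_along
         (fun n => [/\ (2 < d n)%N, (d n)%:R < 5^-1 * ln (n%:R : R)
                     & ~~ odd (d n * n)])
         (fun n => prob_uniform R (regular_graphs n (d n))
            (fun G => c * tww_bound n ((d n)%:R : R) <= (tww G)%:R)).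
Proof.
exists c; split; first exact: expR_gt0.
move=> d; apply: tends_to_one_alongP => [n|delta delta0]; first exact: prob_uniform_le1.
have [n0 hn0] := ln_large (6 + 6 * c^-1 / (1 / 4) ^+ 3 + delta^-1).
exists n0 => n /hn0 yB [d2 dy od].
have cV : 0 < c^-1 by rewrite invr_gt0 expR_gt0.
have dV : 0 < delta^-1 by rewrite invr_gt0.
have t3 : 0 < 6 * c^-1 / (1 / 4) ^+ 3 by rewrite divr_gt0 ?mulr_gt0 ?exprn_gt0.
have y6 : 6 <= ln (n%:R : R) by lra.
have [|reg0 bad] := regular_bad d2 od (ltW dy) y6.
  by apply: expR_ge_sqr; lra.
apply: prob_uniform_ge => //; apply: le_trans bad _; apply: ler_wpM2r => //.
have y0 : 0 < ln (n%:R : R) by lra.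
have := expR_ge1Dx (n%:R : R); have := expR_ge1Dx (ln (n%:R : R)); rewrite -natr_expR_ln // => h1 h2.
rewrite expRN -[delta]invrK lef_pV2 ?posrE ?expR_gt0 //; lra.
Qed.

End Regular.

(** * Graphs with a given number of edges and maximum average degree *)

(** The whole graph is admissible, so the maximum is attained and is at least the average degree of
    [G]. *)
Lemma mad_witness (R : realType) (T : finType) (G : sgraph T) : (0 < #|T|)%N ->
  exists (U : {set T}) (F : {set {set T}}),
    [/\ F \subset edges G, F \subset pairs U, (0 < #|U|)%N,
        mad R G = (2 * #|F|)%N%:R / #|U|%:R
      & (2 * #|edges G|)%N%:R / #|T|%:R <= mad R G].
Proof.
move=> T0; pose H0 := ([set: T], edges G).
have H0P : is_subgraph H0 G && (H0.1 != finset.set0).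
  by rewrite /is_subgraph /= fintype.subxx (edges_sub G) -card_gt0 cardsT.
pose f (H : {set T} * {set {set T}}) : R := (2 * #|H.2|)%N%:R / #|H.1|%:R.
have [[U F] UF Emad] := @eq_bigmax _ R _ 0 H0
  (fun H => is_subgraph H G && (H.1 != finset.set0)) f H0P
  (fun _ _ => divr_ge0 (ler0n _ _) (ler0n _ _)).
move: UF; rewrite unfold_in /= => /andP[/andP[FG FU] U0].
exists U, F; split => //; first by rewrite card_gt0.
have := @le_bigmax_cond _ R _ 0 H0 (fun H => is_subgraph H G && (H.1 != finset.set0)) f H0P.
by rewrite /f /= cardsT.
Qed.

Lemma sum_card_sets (R : nmodType) (T : finType) (p : pred nat) (f : nat -> R) :
  \sum_(U : {set T} | p #|U|) f #|U| = \sum_(u < #|T|.+1 | p u) f u *+ 'C(#|T|, u).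
Proof.
have cU (U : {set T}) : (#|U| < #|T|.+1)%N by rewrite ltnS max_card.
rewrite (partition_big (fun U : {set T} => Ordinal (cU U)) (fun u : 'I_ _ => p u)) //=.
apply: eq_bigr => u pu; rewrite -card_draws -sumr_const.
apply: eq_big => [U|U /andP[_ /eqP <-]] //.
by rewrite inE -val_eqE /=; case: eqP => [->|]; rewrite ?pu ?andbF.
Qed.

Lemma geometric_sum_le (R : realFieldType) (z : R) n : 0 <= z -> z <= 1 / 2 ->
  \sum_(u < n.+1 | (0 < u)%N) z ^+ u <= 2 * z.
Proof.
move=> z0 z1; rewrite big_mkcond big_ord_recl /= add0r.
(* The factor [1 - z ^+ n] makes the induction go through. *)
suff : \sum_(i < n) z ^+ i.+1 <= 2 * z * (1 - z ^+ n) by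
  have zn : 0 <= z ^+ n := exprn_ge0 n z0; nra.
elim: n => [|n IH]; first by rewrite big_ord0 expr0 subrr mulr0.
rewrite big_ord_recr /= (le_trans (lerD IH (lexx _))) // exprS.
have zn : 0 <= z ^+ n := exprn_ge0 n z0.
rewrite -subr_ge0 (_ : _ - _ = z ^+ n * z * (1 - 2 * z)); last by ring.
by rewrite !mulr_ge0 // subr_ge0; lra.
Qed.

Section EdgeModel.
Variables (R : realType) (n m : nat).
Notation y := (ln (n%:R : R)).
Notation Om := (graphs_with_edges n m).
Hypotheses (y6 : 6 <= y) (my : (m%:R : R) <= 11^-1 * n%:R * y).

Definition meeting (P : {set {set 'I_n}}) (j : nat) : {set sgraph 'I_n} :=
  [set G : sgraph 'I_n | (#|edges G| == m) && (j <= #|edges G :&: P|)%N].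

Lemma n_expR : (n%:R : R) = expR y.
Proof. by have h := y6; apply: natr_expR_ln; lra. Qed.

Lemma n_gt : y + 1 <= (n%:R : R).
Proof. by rewrite [leRHS]n_expR addrC expR_ge1Dx. Qed.

Lemma card_pairs_ge : (n%:R ^+ 2 / 4 : R) <= ('C(n, 2)%:R : R).
Proof.
have h := y6; have h1 := n_gt.
have n0 : (0 < n)%N by rewrite -(ltr0n R); lra.
have : (2 * 'C(n, 2) = n * n.-1)%N.
  by rewrite bin2 mul2n; have := odd_double_half (n * n.-1);
     rewrite oddM; case: (n) n0 => //= k _; case: (odd k).
move/(congr1 (fun z => z%:R : R)); rewrite !natrM -subn1 natrB //; nra.
Qed.

Lemma m_le : (m <= 'C(n, 2))%N.
Proof.
have h := y6; have h1 := n_gt; have h2 := my; have h3 := card_pairs_ge.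
rewrite -(ler_nat R); nra.
Qed.

Lemma graphs_with_edges_gt0 : (0 < #|Om|)%N.
Proof.
rewrite (card_graphs (fun E => #|E| == m)) cards_draws card_pairs cardsT card_ord.
by rewrite bin_gt0 m_le.
Qed.

(** The base combines [bin_le_expR] with the edge density, at most [4 * m / n ^ 2] by
    [card_pairs_ge]. *)
Lemma card_meeting_le (P : {set {set 'I_n}}) (M j : nat) (beta : R) : (#|P| <= M)%N ->
  expR 1 * M%:R / j%:R * (4 * m%:R / n%:R ^+ 2) <= beta ->
  (#|meeting P j|%:R : R) <= beta ^+ j * #|Om|%:R.
Proof.
move=> PM hb; have h := y6; have h1 := n_gt; have h3 := card_pairs_ge.
have nR : 0 < (n%:R : R) by lra.
have NR : 0 < ('C(n, 2)%:R : R) by apply: lt_le_trans h3; rewrite divr_gt0 ?exprn_gt0.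
have := @card_graphs_meeting 'I_n 'C(n, 2) m P j.
rewrite card_pairs cardsT card_ord => /(_ erefl m_le).
rewrite -(ler_nat R) !natrM !natrX -ler_pdivlMr ?exprn_gt0 // => hc.
apply: le_trans hc _; rewrite mulrAC; apply: ler_wpM2r; first exact: ler0n.
rewrite -mulrA -expr_div_n.
apply: (@le_trans _ _ ((expR 1 * M%:R / j%:R) ^+ j * (m%:R / 'C(n, 2)%:R) ^+ j)).
  apply: ler_wpM2r; first by rewrite exprn_ge0 // divr_ge0.
  by apply: le_trans (bin_le_expR _ _ _); rewrite ler_nat leq_bin2l.
rewrite -exprMn.
have b0 : 0 <= expR 1 * M%:R / j%:R :> R by rewrite divr_ge0 // mulr_ge0 ?expR_ge0.
have q0 : 0 <= m%:R / 'C(n, 2)%:R :> R by rewrite divr_ge0.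
have le1 : expR 1 * M%:R / j%:R * (m%:R / 'C(n, 2)%:R) <= beta.
  apply: le_trans hb; apply: ler_wpM2l => //.
  rewrite ler_pdivrMr // mulrAC ler_pdivlMr ?exprn_gt0 //.
  by rewrite [4 * _]mulrC -mulrA; apply: ler_wpM2l => //; lra.
apply: lerXn2r; rewrite ?nnegrE //.
by apply: le_trans le1; rewrite mulr_ge0.
Qed.

Lemma card_star (x : 'I_n) : (#|[set e in pairs [set: 'I_n] | x \in e]| <= n)%N.
Proof.
rewrite -[leqRHS]card_ord; apply: leq_trans (leq_imset_card (fun z => [set x; z]) 'I_n).
apply: subset_leq_card; apply/fintype.subsetP => e; rewrite !inE => /andP[/andP[_ h] xe].
move: h xe => /cards2P[a [b [_ ->]]]; rewrite !inE => /orP[]/eqP->; apply/imsetP.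
  by exists b.
by exists a => //; rewrite finset.setUC.
Qed.

Let K : R := expR 3.

(** Since [m <= n * y / 11] and [j >= expR 3 * y], the base for a star is at most
    [expR 1 * (4 / 11) * y / j <= expR (- 2)]. As [j >= y], the sum over all vertices is at most
    [n * n ^ (- 2)]. *)
Lemma high_degree_le :
  (#|\bigcup_(x : 'I_n) meeting [set e in pairs [set: 'I_n] | x \in e]
       (Num.truncn (K * y)).+1|%:R : R) <= expR (- y) * #|Om|%:R.
Proof.
have h := y6; have h1 := n_gt; have h2 := my; set j := (Num.truncn _).+1.
have K0 : 0 < K := expR_gt0 _.
have K1 : 1 <= K by have := expR_ge1Dx (3 : R); rewrite /K; lra.
have jK : K * y <= j%:R by apply/ltW/truncnS_gt.
have j0 : 0 < (j%:R : R) by rewrite ltr0n.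
have nR : 0 < (n%:R : R) by lra.
have one x : (#|meeting [set e in pairs [set: 'I_n] | x \in e] j|%:R : R)
    <= expR (- 2) ^+ j * #|Om|%:R.
  apply: card_meeting_le (card_star x) _.
  have -> : expR 1 * n%:R / j%:R * (4 * m%:R / n%:R ^+ 2) =
    (expR 1 * 4 * (m%:R / n%:R)) / j%:R :> R by field; rewrite !lt0r_neq0.
  rewrite ler_pdivrMr //; apply: le_trans (_ : _ <= expR (- 2) * (K * y)) _; last first.
    by apply: ler_wpM2l => //; exact: expR_ge0.
  rewrite /K mulrA -expRD (_ : - 2 + 3 = 1); last by lra.
  rewrite -mulrA; apply: ler_wpM2l; first exact: expR_ge0.
  have : m%:R / n%:R <= y / 11 :> R by rewrite ler_pdivrMr //; lra.
  lra.
apply: (@le_trans _ _ (\sum_(x : 'I_n) (expR (- 2) ^+ j * #|Om|%:R))).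
  apply: (@le_trans _ _ (\sum_(x : 'I_n) (#|meeting [set e in pairs [set: 'I_n] | x \in e] j|%:R : R))).
    by rewrite -natr_sum ler_nat leq_card_bigcup.
  by apply: ler_sum => x _.
have -> : \sum_(x : 'I_n) (expR (- 2) ^+ j * #|Om|%:R) = n%:R * expR (- 2) ^+ j * #|Om|%:R :> R.
  by rewrite sumr_const card_ord -mulrA mulr_natl.
apply: ler_wpM2r; first exact: ler0n.
rewrite {1}n_expR -expRM_natl -expRD ler_expR.
have : y <= K * y by rewrite ler_peMl //; lra.
lra.
Qed.

Variable eta : R.
Hypotheses (eta0 : 0 < eta) (eta1 : eta <= 1) (yeta : 3 + 2 * ln y <= eta * y / 8).

Definition dense_size (u : nat) : nat := (Num.truncn ((1 + eta) * u%:R)).+1.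

(** The choice of [U] costs [1 + y - ln u] per vertex, and each of the [(1 + eta) * u] edges gains
    [y - ln u - ln y - 1]. As [ln u <= 3 / 4 * y], the surplus [eta * (y - ln u)] is at least
    [eta * y / 4]; half of it absorbs [3 + 2 * ln y], and the rest gives a geometric series in
    [u]. *)
Lemma dense_small_le :
  (#|\bigcup_(U : {set 'I_n} | (0 < #|U|)%N && (#|U|%:R < n%:R `^ (3 / 4) :> R))
      meeting (pairs U) (dense_size #|U|)|%:R : R) <= 2 * expR (- (eta * y / 8)) * #|Om|%:R.
Proof.
have h := y6; have h1 := n_gt; have h2 := my; have e0 := eta0; have e1 := eta1; have ye := yeta.
have nR : 0 < (n%:R : R) by lra.
have ly0 : 0 <= ln y by apply: ln_ge0; lra.
pose p u := (0 < u)%N && (u%:R < n%:R `^ (3 / 4) :> R).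
pose z := expR (- (eta * y / 8)).
pose b u := expR (1 + ln u%:R + ln y - y) : R.
have one (U : {set 'I_n}) : p #|U| -> (#|meeting (pairs U) (dense_size #|U|)|%:R : R) <=
    b #|U| ^+ dense_size #|U| * #|Om|%:R.
  move=> /andP[U0 _]; apply: card_meeting_le (leqnn _) _; rewrite card_pairs.
  set u := #|U| in U0 *; set j := dense_size u.
  have uR : 0 < (u%:R : R) by rewrite ltr0n.
  have uj : (u%:R : R) <= j%:R.
    apply: le_trans (ltW (truncnS_gt _)); rewrite mulrDl mul1r lerDl mulr_ge0 //; exact: ltW.
  have j0 : 0 < (j%:R : R) by lra.
  have bu : ('C(u, 2)%:R : R) <= u%:R ^+ 2.
    by rewrite -natrX ler_nat bin2 -divn2; apply: leq_trans (leq_div _ _) _;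
       rewrite expnS expn1 leq_mul // leq_pred.
  rewrite /b expRD expRN expRD expRD !lnK ?posrE //; last lra.
  have -> : expR 1 * 'C(u, 2)%:R / j%:R * (4 * m%:R / n%:R ^+ 2) =
     expR 1 * ('C(u, 2)%:R / j%:R) * (4 * (m%:R / n%:R)) / n%:R :> R.
    by field; rewrite !lt0r_neq0.
  apply: ler_wpM2r; first by rewrite invr_ge0.
  have mn : m%:R / n%:R <= y / 11 :> R by rewrite ler_pdivrMr //; lra.
  apply: ler_pM; rewrite ?mulr_ge0 ?divr_ge0 ?expR_ge0 //.
    apply: ler_wpM2l; first exact: expR_ge0.
    rewrite ler_pdivrMr //; apply: le_trans bu _; rewrite expr2; apply: ler_wpM2l => //; exact: ltW.
  lra.
apply: (@le_trans _ _ (\sum_(U : {set 'I_n} | p #|U|) (b #|U| ^+ dense_size #|U| * #|Om|%:R))).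
  apply: (@le_trans _ _ (\sum_(U : {set 'I_n} | p #|U|) (#|meeting (pairs U) (dense_size #|U|)|%:R : R))).
    by rewrite -natr_sum ler_nat leq_card_bigcup.
  by apply: ler_sum.
rewrite -mulr_suml; apply: ler_wpM2r; first exact: ler0n.
rewrite (sum_card_sets _ p (fun u => b u ^+ dense_size u)) card_ord.
apply: (@le_trans _ _ (\sum_(u < n.+1 | p u) z ^+ u)); last first.
  apply: (@le_trans _ _ (\sum_(u < n.+1 | (0 < u)%N) z ^+ u)).
    rewrite [leRHS](bigID (fun u : 'I_n.+1 => (u%:R < n%:R `^ (3 / 4) :> R))) /= lerDl.
    by apply: sumr_ge0 => u _; rewrite exprn_ge0 // expR_ge0.
  apply: geometric_sum_le; first exact: expR_ge0.
  rewrite /z expRN -[1 / 2]invrK lef_pV2 ?posrE ?expR_gt0 ?invr_gt0 ?divr_gt0 //.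
  have := expR_ge1Dx (eta * y / 8); have -> : (1 / 2)^-1 = 2 :> R by rewrite div1r invrK.
  lra.
apply: ler_sum => u /andP[u0 un].
have uR : 0 < (u%:R : R) by rewrite ltr0n.
have lu : ln u%:R <= 3 / 4 * y :> R.
  have -> : 3 / 4 * y = ln (n%:R `^ (3 / 4)) by rewrite ln_powR.
  by rewrite ler_ln ?posrE ?powR_gt0 // ltW.
(* Thus [b u <= 1], and the integer exponent may be lowered to [(1 + eta) * u]. *)
have bneg : 1 + ln u%:R + ln y - y <= 0.
  have : eta * y <= y by rewrite ler_piMl //; lra.
  lra.
rewrite -mulr_natl.
apply: (@le_trans _ _ (expR (u%:R * (1 + y - ln u%:R)) *
     expR ((1 + eta) * u%:R * (1 + ln u%:R + ln y - y)))).
  apply: ler_pM; rewrite ?exprn_ge0 ?expR_ge0 //.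
    apply: le_trans (bin_le_expR _ _ _) _.
    rewrite exprn_expR_ln ?divr_gt0 ?mulr_gt0 ?expR_gt0 //.
    by rewrite !lnM ?posrE ?mulr_gt0 ?invr_gt0 ?expR_gt0 // expRK lnV ?posrE.
  rewrite /b -expRM_natl ler_expR; apply: ler_wnM2r => //.
  exact/ltW/truncnS_gt.
rewrite -expRD /z -expRM_natl ler_expR.
have -> : u%:R * (1 + y - ln u%:R) + (1 + eta) * u%:R * (1 + ln u%:R + ln y - y) =
  u%:R * ((1 + y - ln u%:R) + (1 + eta) * (1 + ln u%:R + ln y - y)) by ring.
apply: ler_wpM2l; first exact: ltW.
have : eta * ln u%:R <= eta * (3 / 4 * y) by apply: ler_wpM2l lu; exact: ltW.
have : eta * ln y <= ln y by rewrite ler_piMl.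
lra.
Qed.

End EdgeModel.

(** * The union bound for graphs with a given number of edges *)

Section Final.
Variable R : realType.
Let K : R := expR 3.
(** The factor [expR 1] of [bin_le_expR] times the 4 of [card_pairs_ge]. *)
Let C : R := 4 * expR 1.
Let l : R := 2 * (11 + 4 * K) + ln (32 * C).
Let c : R := expR (- l).

Let K1 : 1 <= K. Proof. have := expR_ge1Dx (3 : R); rewrite /K; lra. Qed.
Let C1 : 1 <= C. Proof. have := expR_ge1Dx (1 : R); rewrite /C; lra. Qed.
Let c1 : c <= 1.
Proof. rewrite -expR0 ler_expR; have := ln_inv_c_ge1 K1 C1 erefl; rewrite -/l; lra. Qed.

Section Fixed.
Variables (n m : nat) (eps : R).
Notation y := (ln (n%:R : R)).
Notation Om := (graphs_with_edges n m).
Hypotheses (y6 : 6 <= y) (my : (m%:R : R) <= 11^-1 * n%:R * y).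
Hypotheses (eps0 : 0 < eps) (mn : (1 + eps) * n%:R <= m%:R).
Hypothesis yA : K ^+ 2 / c * y ^+ 2 <= expR (eps / (1 + 2 * eps) * y).
Hypothesis y34 : 1 * y ^+ 2 <= expR (3 / 4 * y).

Definition piece_sizen (d : R) : nat := (Num.truncn (piece_size n d)).+1.
Definition width (d : R) : nat := Num.truncn (c * tww_bound n d).

(** The value of [mad] is random, but piece size and width must be fixed before hulls are
    enumerated; they are fixed by the pair [(u, e)], over which a further union bound is taken. *)
Definition structured (u e : nat) : {set sgraph 'I_n} :=
  let d := 2 * e%:R / u%:R in
  \bigcup_(U : {set 'I_n} | #|U| == u)
    \bigcup_(P in hulls U (u %/ piece_sizen d) ((u %/ piece_sizen d).+1 * (width d).+1)
                        ((2 * piece_sizen d) ^ 2)) meeting m P e.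

(* For [e] edges on [u] vertices [d] is the average degree; outside the events of
   [high_degree_le] and [dense_small_le], a subgraph attaining [mad] has a
   typical pair [(u, e)]. *)
Definition typical (u e : nat) : bool :=
  let d : R := 2 * e%:R / u%:R in
  [&& n%:R `^ (3 / 4) <= u%:R :> R, 2 * m%:R / n%:R <= d & d <= K * y].

Lemma typical_sizes u e : typical u e ->
  let d : R := 2 * e%:R / u%:R in
  [/\ [/\ (0 < n)%N, (0 < u)%N, 2 + 2 * eps <= d & 2 <= d],
      piece_size n d <= (piece_sizen d)%:R, (piece_sizen d)%:R <= 2 * piece_size n d,
      K * y < (piece_sizen d)%:R
    & 1 <= c * tww_bound n d /\ (piece_sizen d <= u)%N].
Proof.
move=> /and3P[un md dK] d; rewrite -/d in md dK.
have h := y6; have h1 := n_gt y6; have h2 := eps0; have h3 := mn; have hK := K1.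
have nR : 0 < (n%:R : R) by lra.
have n0 : (0 < n)%N by rewrite -(ltr0n R).
have u0 : (0 < u)%N by rewrite -(ltr0n R); apply: lt_le_trans un; rewrite powR_gt0.
have d2 : 2 + 2 * eps <= d.
  by apply: le_trans md; rewrite ler_pdivlMr //; lra.
have y1 : 1 <= y by lra.
have d2' : 2 <= d by lra.
have yn : y ^+ 2 <= expR y.
  have := y34; rewrite mul1r => /le_trans; apply; rewrite ler_expR; lra.
have [s1 s2 s3 s4 s5] := sizes_large erefl K1 (expR_gt0 _) c1 y1 d2' dK
  (exponent_ge eps0 d2) yA yn.
by split=> //; split=> //; rewrite -(ler_nat R); apply: le_trans s5 un.
Qed.

Lemma structured_le u e : (u <= n)%N -> typical u e ->
  (#|structured u e|%:R : R) <= expR (- (2 * n%:R `^ (3 / 4))) * #|Om|%:R.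
Proof.
move=> un tue; have [[n0 u0 d2e d2] s1 s2 s3 [r1 su]] := typical_sizes tue.
move: tue => /and3P[nu md dK]; rewrite /structured.
set d : R := 2 * e%:R / u%:R in d2e d2 s1 s2 s3 r1 su md dK *.
set s := piece_sizen d in s1 s2 s3 su *; set w := width d.
have uR : 0 < (u%:R : R) by rewrite ltr0n.
have nR : 0 < (n%:R : R) by rewrite ltr0n.
have h := y6.
have wr : w%:R <= c * tww_bound n d by rewrite truncn_le; lra.
have Ee : 2 * e%:R = d * u%:R :> R by rewrite /d; field; rewrite lt0r_neq0.
have e0 : 0 < (e%:R : R).
  have : 0 < d * u%:R by rewrite mulr_gt0 //; lra.
  lra.
have ut := union_bound_le K1 C1 (erefl l) (n := n) (u := u) (e := e) (s := s) (w := w) (d := d)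
  ltac:(lra) d2 dK s1 s2 r1 wr ltac:(by rewrite su) un Ee.
set k := (u %/ s)%N in ut *; set q := (k.+1 * w.+1)%N in ut *.
set M := (q * (2 * s) ^ 2)%N in ut.
set beta := C * M%:R / (u%:R * n%:R) in ut.
have one (U : {set 'I_n}) P : P \in hulls U k q ((2 * s) ^ 2) ->
    (#|meeting m P e|%:R : R) <= beta ^+ e * #|Om|%:R.
  rewrite inE => /andP[_ PM]; apply: (card_meeting_le y6 my PM).
  (* Here [d] is at least the average degree of the whole graph, so the global edge density can be
     replaced by that of the subgraph. *)
  rewrite -/M; have hm : m%:R / (e%:R * n%:R) <= u%:R^-1 :> R.
    rewrite ler_pdivrMr ?mulr_gt0 // mulrC ler_pdivlMr //.
    move: md; rewrite ler_pdivlMr // mulrAC ler_pdivrMr //.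
    lra.
  have -> : expR 1 * M%:R / e%:R * (4 * m%:R / n%:R ^+ 2) =
     C * M%:R / n%:R * (m%:R / (e%:R * n%:R)) by rewrite /C; field; rewrite !lt0r_neq0.
  have -> : beta = C * M%:R / n%:R * u%:R^-1 by rewrite /beta; field; rewrite !lt0r_neq0.
  apply: ler_wpM2l hm; rewrite divr_ge0 ?mulr_ge0 ?ler0n //; have := C1; lra.
have b0 : 0 <= beta ^+ e.
  by rewrite exprn_ge0 // divr_ge0 ?mulr_ge0 ?ler0n //; have := C1; lra.
pose Z := (k.+1 ^ u * #|[set Q : {set 'I_k.+1 * 'I_k.+1} | (#|Q| <= q)%N]|)%N.
apply: (@le_trans _ _ (\sum_(U : {set 'I_n} | #|U| == u) (Z%:R * (beta ^+ e * #|Om|%:R)))).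
  apply: (@le_trans _ _ (\sum_(U : {set 'I_n} | #|U| == u)
     (#|\bigcup_(P in hulls U k q ((2 * s) ^ 2)) meeting m P e|%:R : R))).
    by rewrite -natr_sum ler_nat leq_card_bigcup.
  apply: ler_sum => U /eqP Uu.
  apply: (@le_trans _ _ (\sum_(P in hulls U k q ((2 * s) ^ 2)) (#|meeting m P e|%:R : R))).
    by rewrite -natr_sum ler_nat leq_card_bigcup.
  apply: (@le_trans _ _ (\sum_(P in hulls U k q ((2 * s) ^ 2)) (beta ^+ e * #|Om|%:R))).
    by apply: ler_sum => P; apply: one.
  rewrite sumr_const -[leLHS]mulr_natl; apply: ler_wpM2r; first by rewrite mulr_ge0.
  by rewrite ler_nat /Z -Uu card_hulls.
rewrite (eq_bigl (fun U : {set 'I_n} => U \in [set U : {set 'I_n} | #|U| == u])); last first.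
  by move=> U; rewrite inE.
rewrite sumr_const card_draws card_ord -[leLHS]mulr_natl !mulrA.
apply: ler_wpM2r; first exact: ler0n.
rewrite -natrM mulnA; apply: le_trans ut _; rewrite ler_expR lerN2.
by apply: ler_pM => //; rewrite powR_ge0.
Qed.

Lemma structured_total_le :
  (#|\bigcup_(z : 'I_n.+1 * 'I_(n ^ 2).+1 | typical z.1 z.2) structured z.1 z.2|%:R : R)
    <= expR (- y) * #|Om|%:R.
Proof.
have h := y6; have h1 := n_gt y6; have nR : 0 < (n%:R : R) by lra.
pose b : R := expR (- (2 * n%:R `^ (3 / 4))) * #|Om|%:R.
have b0 : 0 <= b by rewrite mulr_ge0 ?expR_ge0.
apply: (@le_trans _ _ (\sum_(z : 'I_n.+1 * 'I_(n ^ 2).+1 | typical z.1 z.2) b)).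
  apply: (@le_trans _ _ (\sum_(z : 'I_n.+1 * 'I_(n ^ 2).+1 | typical z.1 z.2)
     (#|structured z.1 z.2|%:R : R))).
    by rewrite -natr_sum ler_nat leq_card_bigcup.
  by apply: ler_sum => z zt; apply: structured_le zt; rewrite -ltnS.
apply: (@le_trans _ _ (\sum_(z : 'I_n.+1 * 'I_(n ^ 2).+1) b)).
  by rewrite [leRHS](bigID (fun z : 'I_n.+1 * 'I_(n ^ 2).+1 => typical z.1 z.2)) /= lerDl sumr_ge0.
rewrite sumr_const card_prod !card_ord -[leLHS]mulr_natl /b mulrA.
apply: ler_wpM2r; first exact: ler0n.
have n0 : (0 < n)%N by rewrite -(ltr0n R).
have n3 : (4 <= n)%N by rewrite -(ler_nat R); lra.
have n4 : (n.+1 * (n ^ 2).+1 <= n ^ 4)%N.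
  have e4 : (n ^ 4 = n * n * (n * n))%N by rewrite !expnS expn0; ring.
  have nn : (0 < n * n)%N by rewrite muln_gt0 n0.
  rewrite e4 expnS expn1; apply: leq_trans (_ : 2 * n * (2 * (n * n)) <= _)%N.
    by apply: leq_mul; rewrite mul2n -addnn -addn1 leq_add2l.
  rewrite (_ : 2 * n * (2 * (n * n)) = 4 * n * (n * n))%N; last by ring.
  by rewrite !leq_mul2r n3 !orbT.
(* There are at most [n ^ 4] pairs, and [n ^ (3 / 4) >= y ^ 2 >= 6 * y]. *)
apply: (@le_trans _ _ (expR (4 * y) * expR (- (12 * y)))).
  apply: ler_pM; rewrite ?expR_ge0 //.
    by rewrite expRM_natl -n_expR // -natrX ler_nat.
  rewrite ler_expR lerN2 powR_expR_ln; last by lra.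
  have := y34; rewrite mul1r => h3.
  have : 6 * y <= y ^+ 2 by rewrite expr2; apply: ler_wpM2r; lra.
  lra.
rewrite -expRD ler_expR; lra.
Qed.

Variable eta : R.
Hypotheses (eta0 : 0 < eta) (eta1 : eta <= 1) (etaeps : eta < eps).
Hypothesis yeta : 3 + 2 * ln y <= eta * y / 8.

(** Outside [E1] all degrees are at most [K * y]. Outside [E2] a subgraph attaining [mad] has at
    least [n ^ (3 / 4)] vertices, being too dense for a smaller set. Its pair [(u, e)] is then
    typical, and [hulls_cover] puts a bad graph into [E3]. *)
Lemma edge_bad :
  (#|[set G in Om | ~~ (c * tww_bound n (mad R G) <= (tww G)%:R)]|%:R : R)
   <= 4 * expR (- (eta * y / 8)) * #|Om|%:R.
Proof.
have h := y6; have h1 := n_gt y6; have nR : 0 < (n%:R : R) by lra.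
have n0 : (0 < n)%N by rewrite -(ltr0n R).
have K0 : 0 < K := expR_gt0 _.
pose E1 := \bigcup_(x : 'I_n) meeting m [set e in pairs [set: 'I_n] | x \in e]
       (Num.truncn (K * y)).+1.
pose E2 := \bigcup_(U : {set 'I_n} | (0 < #|U|)%N && (#|U|%:R < n%:R `^ (3 / 4) :> R))
      meeting m (pairs U) (dense_size eta #|U|).
pose E3 := \bigcup_(z : 'I_n.+1 * 'I_(n ^ 2).+1 | typical z.1 z.2) structured z.1 z.2.
have sub : [set G in Om | ~~ (c * tww_bound n (mad R G) <= (tww G)%:R)]
    \subset E1 :|: E2 :|: E3.
  apply/fintype.subsetP => G; rewrite inE -ltNge inE => /andP[/eqP Gm Gt].
  have T0 : (0 < #|'I_n|)%N by rewrite card_ord.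
  have [U [F [FG FU U0 Emad madm]]] := @mad_witness R _ G T0.
  rewrite inE; case: (boolP (G \in E1)) => [GE1|GE1]; first by rewrite inE GE1.
  have deg x : (degree G x <= Num.truncn (K * y))%N.
    rewrite leqNgt; apply: contra GE1 => dx; apply/bigcupP; exists x => //.
    rewrite inE Gm eqxx /=; apply: leq_trans dx _; apply: subset_leq_card.
    apply/fintype.subsetP => e; rewrite !inE => /andP[eG xe]; rewrite eG xe andbT /=.
    by have := fintype.subsetP (edges_sub G) _ eG; rewrite inE.
  set u := #|U| in U0 Emad; set e := #|F| in Emad.
  have uR : 0 < (u%:R : R) by rewrite ltr0n.
  have Ed : mad R G = 2 * e%:R / u%:R by rewrite Emad natrM.
  have FGU : F \subset edges G :&: pairs U by rewrite finset.subsetI FG.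
  have md : 2 * m%:R / n%:R <= 2 * e%:R / u%:R :> R.
    by rewrite -Ed; move: madm; rewrite Gm card_ord natrM.
  have dK : 2 * e%:R / u%:R <= K * y.
    have hs := handshake FU.
    have : (2 * e <= u * Num.truncn (K * y))%N.
      rewrite /e -hs -sum_nat_const; apply: leq_sum => x _; apply: leq_trans (deg x).
      apply: subset_leq_card; apply/fintype.subsetP => f; rewrite !inE => /andP[fF ->].
      by rewrite (fintype.subsetP FG).
    rewrite -(ler_nat R) !natrM ler_pdivrMr // => h2; apply: le_trans h2 _.
    rewrite mulrC; apply: ler_wpM2r; first exact: ltW.
    rewrite truncn_le; apply: mulr_ge0; [exact: ltW | lra].
  rewrite inE; apply/orP; case: (ltP (u%:R : R) (n%:R `^ (3 / 4))) => un; [left|right].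
    apply/orP; right; apply/bigcupP; exists U; first by rewrite U0 -/u un.
    rewrite inE Gm eqxx /=; apply: leq_trans (subset_leq_card FGU).
    rewrite /dense_size -/u -/e -(ltr_nat R).
    (* The subgraph is at least as dense as [G]; [eta < eps] leaves room for the strict threshold in
       [dense_size]. *)
    have hm : (1 + eps) * u%:R <= e%:R.
      have hmn := mn; have : (1 + eps) <= m%:R / n%:R by rewrite ler_pdivlMr.
      have : m%:R / n%:R <= e%:R / u%:R :> R by move: md; rewrite -!mulrA; lra.
      move=> a b; rewrite -ler_pdivlMr //; lra.
    apply: le_lt_trans (_ : (1 + eta) * u%:R < _).
      by rewrite truncn_le mulr_ge0 //; have := eta0; lra.
    by apply: lt_le_trans hm; rewrite ltr_pM2r // ltrD2l.
  have tue : typical u e by rewrite /typical un md dK.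
  have [[_ _ d2e d2] s1 s2 s3 [r1 su]] := typical_sizes tue.
  have un1 : (u < n.+1)%N by rewrite ltnS -[n in leqRHS]card_ord max_card.
  have en1 : (e < (n ^ 2).+1)%N.
    rewrite ltnS; apply: leq_trans (subset_leq_card FU) _; rewrite card_pairs bin2 -divn2.
    apply: leq_trans (leq_div _ _) _; rewrite expnS expn1.
    by apply: leq_mul; [rewrite -ltnS | apply: leq_trans (leq_pred _) _; rewrite -ltnS].
  apply/bigcupP; exists (Ordinal un1, Ordinal en1) => //=.
  apply/bigcupP; exists U => //.
  set s := piece_sizen _ in s1 s2 s3 su *; set w := width _.
  have tG : tww_at_most G w by apply: tww_at_most_truncn => //; rewrite -Ed.
  have dG x : (degree G x < s)%N.
    rewrite -(ltr_nat R); apply: le_lt_trans s3.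
    apply: (@le_trans _ _ (Num.truncn (K * y))%:R); first by rewrite ler_nat.
    rewrite truncn_le; apply: mulr_ge0; [exact: ltW | lra].
  have s_gt1 : (1 < s)%N.
    rewrite -(ltr_nat R); apply: le_lt_trans s3.
    have : 1 * y <= K * y by apply: ler_wpM2r; [lra | exact: K1].
    lra.
  have [P PH sub] := hulls_cover U s_gt1 dG tG.
  apply/bigcupP; exists P; first by [].
  rewrite inE Gm eqxx /=; apply: subset_leq_card.
  by rewrite finset.subsetI FG (fintype.subset_trans FGU sub).
have A1 := high_degree_le y6 my.
have A2 := dense_small_le y6 my eta0 eta1 yeta.
have A3 := structured_total_le.
have ey : expR (- y) <= expR (- (eta * y / 8)).
  rewrite ler_expR lerN2; have : eta * y <= 1 * y by apply: ler_wpM2r; [lra | exact: eta1].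
  lra.
apply: (@le_trans _ _ (#|E1|%:R + #|E2|%:R + #|E3|%:R)).
  rewrite -!natrD ler_nat; apply: leq_trans (subset_leq_card sub) _.
  apply: leq_trans (leq_card_setU _ _) _; rewrite leq_add2r; exact: leq_card_setU.
have O0 : 0 <= (#|Om|%:R : R) by exact: ler0n.
have := ler_wpM2r O0 ey; rewrite -/E1 in A1; rewrite -/E2 in A2; rewrite -/E3 in A3.
rewrite -!mulrA in A2 *; lra.
Qed.

End Fixed.

Lemma edge_part (eps : R) : 0 < eps ->
     exists c : R, 0 < c /\
     forall m : nat -> nat,
       tends_to_one_along
         (fun n => (1 + eps) * n%:R <= (m n)%:R
                   /\ (m n)%:R <= 11^-1 * n%:R * ln (n%:R : R))
         (fun n => prob_uniform R (graphs_with_edges n (m n))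
            (fun G => c * tww_bound n (mad R G) <= (tww G)%:R)).
Proof.
move=> eps0; exists c; split; first exact: expR_gt0.
move=> m; apply: tends_to_one_alongP => [n|delta delta0]; first exact: prob_uniform_le1.
pose eta := Num.min eps 1 / 2.
have mn0 : 0 < Num.min eps 1 by rewrite lt_min eps0 ltr01.
have eta0 : 0 < eta by rewrite divr_gt0.
have mn1 : Num.min eps 1 <= 1 by rewrite ge_min lexx orbT.
have mne : Num.min eps 1 <= eps by rewrite ge_min lexx.
have eta1 : eta <= 1 by rewrite /eta; lra.
have etaeps : eta < eps by rewrite /eta; lra.
pose t := eps / (1 + 2 * eps).
have t0 : 0 < t by rewrite divr_gt0 //; lra.
have K2c : 0 <= K ^+ 2 / c by rewrite divr_ge0 ?exprn_ge0 ?expR_ge0.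
(* [B1], [B2] and [B3] are the thresholds of [expR_ge_sqr] for [yA], [y34] and, after taking
   logarithms, [yeta]; [B4] makes [4 * expR (- (eta * y / 8))] at most [delta]. *)
pose B1 := 6 * (K ^+ 2 / c) / t ^+ 3.
pose B2 := 6 * 1 / (3 / 4 : R) ^+ 3.
pose B3 := 6 * expR 3 / (eta / 8) ^+ 3.
pose B4 := (8 / eta) * (4 / delta).
have B1p : 0 <= B1 by apply: divr_ge0; [exact: mulr_ge0 | rewrite exprn_ge0 // ltW].
have B2p : 0 <= B2 by rewrite /B2 mulr1 divr_ge0 ?exprn_ge0 //; lra.
have B3p : 0 <= B3 by apply: divr_ge0; [rewrite mulr_ge0 ?expR_ge0 | rewrite exprn_ge0 // divr_ge0 // ltW].
have B4p : 0 <= B4 by apply: mulr_ge0; rewrite divr_ge0 // ltW.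
have [n0 hn0] := ln_large (6 + B1 + B2 + B3 + B4).
exists n0 => n /hn0 yB [mn my].
set y := ln (n%:R : R) in yB my *.
have y6 : 6 <= y by lra.
have y0 : 0 < y by lra.
have hB1 : B1 <= y by lra.
have hB2 : B2 <= y by lra.
apply: prob_uniform_ge; first exact: graphs_with_edges_gt0 y6 my.
have yeta : 3 + 2 * ln y <= eta * y / 8.
  have : expR 3 * y ^+ 2 <= expR (eta / 8 * y).
    by apply: expR_ge_sqr; rewrite ?expR_ge0 ?divr_gt0 // -/B3; lra.
  rewrite -ler_ln ?posrE ?mulr_gt0 ?exprn_gt0 ?expR_gt0 // lnM ?posrE ?exprn_gt0 ?expR_gt0 //.
  rewrite !expRK lnXn //; lra.
apply: le_trans (edge_bad y6 my eps0 mn _ _ eta0 eta1 etaeps yeta) _.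
- by apply: expR_ge_sqr hB1 => //; lra.
- by apply: expR_ge_sqr hB2 => //; lra.
apply: ler_wpM2r => //; rewrite -/y expRN ler_pdivrMr ?expR_gt0 //.
have := expR_ge1Dx (eta * y / 8).
have : 4 / delta <= eta * y / 8.
  have -> : eta * y / 8 = (eta / 8) * y by rewrite mulrAC.
  rewrite -ler_pdivrMl ?divr_gt0 // invf_div -/B4; lra.
rewrite [4 / delta <= _]ler_pdivrMr // => h1 h2; rewrite mulrC; apply: le_trans h1 _.
by apply: ler_wpM2r; [exact: ltW | lra].
Qed.

End Final.

Theorem theorem1p5 (R : realType) :
  (exists c : R, 0 < c /\
     forall d : nat -> nat,
       tends_to_one_along
         (fun n => [/\ (2 < d n)%N, (d n)%:R < 5^-1 * ln (n%:R : R)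
                     & ~~ odd (d n * n)])
         (fun n => prob_uniform R (regular_graphs n (d n))
            (fun G => c * tww_bound n ((d n)%:R : R) <= (tww G)%:R)))
  /\
  (forall eps : R, 0 < eps ->
     exists c : R, 0 < c /\
     forall m : nat -> nat,
       tends_to_one_along
         (fun n => (1 + eps) * n%:R <= (m n)%:R
                   /\ (m n)%:R <= 11^-1 * n%:R * ln (n%:R : R))
         (fun n => prob_uniform R (graphs_with_edges n (m n))
            (fun G => c * tww_bound n (mad R G) <= (tww G)%:R))).
Proof. by split; [exact: regular_part | move=> eps; exact: edge_part]. Qed.
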